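(* For every $\epsilon>0$ there is a constant $C_\epsilon<\infty$ such that for every finite field $\mathbb{F}$ of prime order in which $-1$ is not a square, the extension constant of the $3$-dimensional paraboloid $\mathcal{P}=\{(\omega,\omega\cdot\omega):\omega\in\mathbb{F}_*^2\}\subset\mathbb{F}_*^3$ satisfies $$\mathcal{R}^{*}\left(2\rightarrow\frac{18}{5}-\frac{1}{1035}+\epsilon\right)\le C_\epsilon.$$
   Context: Let $\mathbb{F}$ be a finite field, $e(\cdot)$ a fixed non-principal additive character of $\mathbb{F}$, and $x\cdot\xi=\sum_i x_i\xi_i$. The space $\mathbb{F}^n$ carries counting measure $dx$; $\mathbb{F}_*^n$ denotes its (isomorphic) dual. Norms: $\|f\|_{L^q(\mathbb{F}^n,dx)}=(\sum_{x\in\mathbb{F}^n}|f(x)|^q)^{1/q}$. For nonempty $S\subset\mathbb{F}_*^n$, $d\sigma$ is the measure assigning mass $|S|^{-1}$ to each point of $S$, so $\|g\|_{L^p(S,d\sigma)}=(|S|^{-1}\sum_{\xi\in S}|g(\xi)|^p)^{1/p}$, and $(g\,d\sigma)^\vee(x)=|S|^{-1}\sum_{\xi\in S}g(\xi)e(x\cdot\xi)$ for $x\in\mathbb{F}^n$. For $1\le p,q\le\infty$, $\mathcal{R}^*(p\to q)$ is the best constant such that $\|(g\,d\sigma)^\vee\|_{L^q(\mathbb{F}^n,dx)}\le\mathcal{R}^*(p\to q)\|g\|_{L^p(S,d\sigma)}$ for all $g:S\to\mathbb{C}$. Here $n=3$ and $S=\mathcal{P}$. *)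

(* Defs.v *)
(* MathComp / MathComp-Analysis world: R is an arbitrary realType, R[i] its complex numbers. *)
From HB Require Import structures.
From mathcomp Require Import all_boot all_order all_algebra.
From mathcomp Require Import all_classical all_reals all_analysis.
From mathcomp Require Export complex.

Set Implicit Arguments.
Unset Strict Implicit.
Unset Printing Implicit Defensive.

Import Order.TTheory GRing.Theory Num.Theory.

Local Open Scope ring_scope.
Local Open Scope complex_scope.

Section Extension.

Variables (R : realType) (F : finFieldType).

(* A homomorphism from (F, +) to the multiplicative monoid of R[i]; the equation
   e 0 = 1 forces its values to be nonzero. *)
Definition additive_character (e : F -> R[i]) : Prop :=
  e 0 = 1 /\ forall x y, e (x + y) = e x * e y.

Definition nonprincipal (e : F -> R[i]) : Prop := exists x, e x != 1.

(* Both F^n and its dual are represented by 'rV[F]_n. *)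
Definition dotp n (x xi : 'rV[F]_n) : F := \sum_i x 0 i * xi 0 i.

(* The modulus as an element of R: the norm `|z| of R[i] has type R[i]. *)
Definition cmod (z : R[i]) : R := complex.Re `|z|.

Definition Lq_norm n (q : R) (f : 'rV[F]_n -> R[i]) : R :=
  (\sum_x cmod (f x) `^ q) `^ q^-1.

(* A function on S is given by a function g on the whole space; only its values
   on S matter in the two definitions below. *)
Definition Lp_norm_sigma n (S : {set 'rV[F]_n}) (p : R) (g : 'rV[F]_n -> R[i]) : R :=
  (#|S|%:R^-1 * \sum_(xi in S) cmod (g xi) `^ p) `^ p^-1.

Definition extension n (S : {set 'rV[F]_n}) (e : F -> R[i])
    (g : 'rV[F]_n -> R[i]) (x : 'rV[F]_n) : R[i] :=
  #|S|%:R^-1 * \sum_(xi in S) g xi * e (dotp x xi).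

(* The best constant R^*(p -> q), for finite exponents p and q. *)
Definition extension_constant n (S : {set 'rV[F]_n}) (e : F -> R[i]) (p q : R)
    : \bar R :=
  ereal_inf [set A%:E | A in [set A : R | 0 <= A /\
    forall g : 'rV[F]_n -> R[i],
      Lq_norm q (extension S e g) <= A * Lp_norm_sigma S p g]]%classic.

End Extension.

Definition paraboloid (F : finFieldType) : {set 'rV[F]_3} :=
  [set (row_mx w (dotp w w)%:M : 'rV[F]_(2 + 1)) | w in [set: 'rV[F]_2]].

(* Main.v *)
(** Let [E] be a set on which the extension [h] of [g] is at least [lam] times the
    L^2 norm of [g], let [N = #|E|] and let [E_z] be its horizontal slices.  By
    duality [lam^2 N^2] is at most the sum over [x, y] in [E] of the kernel at
    [x - y].  The kernel is a Gaussian of modulus [#|F|^-1] off its plane of zero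
    height, and completing the square shows that the contribution of [y] in [E_z]
    is [#|F|^-1] times the exponential sum over [E_z], lifted to the paraboloid,
    evaluated at [psi_z x] for the pseudo-conformal map [psi_z].  Hence
    [lam^2 N^2 <= N + #|F|^-1 sum_z M_z], where [M_z] sums over [x] in [E] the
    moduli of these exponential sums.

    Since -1 is not a square, an additive quadruple on the paraboloid is a
    rectangle and a set of [n] points has energy [O(n^(5/2))]; the resulting bound
    on the fourth moment of the exponential sums leads to the exponent 18/5.

    The gain comes from the almost additive structure of large spectra: if [M_z] is
    close to its maximum then [psi_z E] has large additive energy.  This
    cannot happen for many [z].  After pigeonholing the heights, an additive
    quadruple of [psi_z E] satisfies [(x1 - x3) (t2 - z) = (x2 - x4) (t1 - z)] with
    [x1, x3] at height [t1] and [x2, x4] at height [t2], and this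
    relation determines [z] unless it is degenerate. *)
Require Import Defs.
From mathcomp Require Import all_boot all_order all_algebra.
From mathcomp Require Import all_classical all_reals all_analysis.
From mathcomp Require Import ring lra zify.

Set Implicit Arguments.
Unset Strict Implicit.
Unset Printing Implicit Defensive.

Import Order.TTheory GRing.Theory Num.Theory.
Local Open Scope ring_scope.
Local Open Scope complex_scope.

(** * Sums and collisions *)

Lemma big_setX (V : nmodType) (S T : finType) (A : {set S}) (B : {set T})
    (f : S * T -> V) :
  \sum_(p in finset.setX A B) f p = \sum_(a in A) \sum_(b in B) f (a, b).
Proof.
rewrite pair_big; apply: eq_big => [[a b]|[a b] _] //=.
by rewrite inE.
Qed.

Section Sums.
Variables (R : realDomainType) (I : finType) (P : pred I).

(** The nonnegative double sum of [w i * w j * (u i - u j) ^+ 2] is twice the difference of the two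
    sides. *)
Lemma weighted_sum_sqr (w u : I -> R) : (forall i, P i -> 0 <= w i) ->
  (\sum_(i | P i) w i * u i) ^+ 2
    <= (\sum_(i | P i) w i) * \sum_(i | P i) w i * u i ^+ 2.
Proof.
move=> w0.
have : 0 <= \sum_(i | P i) \sum_(j | P j) w i * w j * (u i - u j) ^+ 2.
  apply: sumr_ge0 => i Pi; apply: sumr_ge0 => j Pj.
  by rewrite mulr_ge0 ?sqr_ge0 // mulr_ge0 ?w0.
have -> : \sum_(i | P i) \sum_(j | P j) w i * w j * (u i - u j) ^+ 2 =
  (\sum_(i | P i) w i * u i ^+ 2) * (\sum_(j | P j) w j)
  + (\sum_(i | P i) w i) * (\sum_(j | P j) w j * u j ^+ 2)
  - 2 * ((\sum_(i | P i) w i * u i) * (\sum_(j | P j) w j * u j)).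
  rewrite !big_distrlr /= mulr_sumr -big_split -sumrB /=.
  apply: eq_bigr => i _; rewrite mulr_sumr -big_split -sumrB /=.
  by apply: eq_bigr => j _; ring.
by nra.
Qed.

Lemma cauchy_schwarz_sum (a b : I -> R) :
  (\sum_(i | P i) a i * b i) ^+ 2
    <= (\sum_(i | P i) a i ^+ 2) * \sum_(i | P i) b i ^+ 2.
Proof.
have : 0 <= \sum_(i | P i) \sum_(j | P j) (a i * b j - a j * b i) ^+ 2.
  by apply: sumr_ge0 => i _; apply: sumr_ge0 => j _; exact: sqr_ge0.
have -> : \sum_(i | P i) \sum_(j | P j) (a i * b j - a j * b i) ^+ 2 =
  (\sum_(i | P i) a i ^+ 2) * (\sum_(j | P j) b j ^+ 2)
  + (\sum_(i | P i) b i ^+ 2) * (\sum_(j | P j) a j ^+ 2)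
  - 2 * ((\sum_(i | P i) a i * b i) * (\sum_(j | P j) a j * b j)).
  rewrite !big_distrlr /= mulr_sumr -big_split -sumrB /=.
  apply: eq_bigr => i _; rewrite mulr_sumr -big_split -sumrB /=.
  by apply: eq_bigr => j _; ring.
by nra.
Qed.

(** Power mean inequality: weighted Cauchy-Schwarz applied to [u], [u ^+ 2] and [u ^+ 4] in turn. *)
Lemma weighted_sum_exp8 (w u : I -> R) :
  (forall i, P i -> 0 <= w i) -> (forall i, P i -> 0 <= u i) ->
  (\sum_(i | P i) w i * u i) ^+ 8
    <= (\sum_(i | P i) w i) ^+ 7 * \sum_(i | P i) w i * u i ^+ 8.
Proof.
move=> w0 u0.
set W := \sum_(i | P i) w i; set s1 := \sum_(i | P i) w i * u i.
have W0 : 0 <= W by apply: sumr_ge0.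
have pos n : 0 <= \sum_(i | P i) w i * u i ^+ n.
  by apply: sumr_ge0 => i Pi; rewrite mulr_ge0 ?exprn_ge0 ?w0 ?u0.
have h1 : s1 ^+ 2 <= W * \sum_(i | P i) w i * u i ^+ 2 := weighted_sum_sqr u w0.
have h2 : (\sum_(i | P i) w i * u i ^+ 2) ^+ 2 <= W * \sum_(i | P i) w i * u i ^+ 4.
  apply: le_trans (weighted_sum_sqr (fun i => u i ^+ 2) w0) _.
  by apply: ler_wpM2l => //; apply: ler_sum => i _; rewrite -exprM.
have h3 : (\sum_(i | P i) w i * u i ^+ 4) ^+ 2 <= W * \sum_(i | P i) w i * u i ^+ 8.
  apply: le_trans (weighted_sum_sqr (fun i => u i ^+ 4) w0) _.
  by apply: ler_wpM2l => //; apply: ler_sum => i _; rewrite -exprM.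
set t2 := \sum_(i | P i) w i * u i ^+ 2 in h1 h2.
set t4 := \sum_(i | P i) w i * u i ^+ 4 in h2 h3.
set t8 := \sum_(i | P i) w i * u i ^+ 8 in h3 *.
have t20 : 0 <= t2 := pos 2%N; have t40 : 0 <= t4 := pos 4%N.
have t80 : 0 <= t8 := pos 8%N.
have e1 : s1 ^+ 8 <= W ^+ 4 * (t2 ^+ 2) ^+ 2.
  rewrite -(exprM t2) -exprMn -[8%N]/(2 * 4)%N (exprM s1).
  by apply: lerXn2r; rewrite ?nnegrE ?sqr_ge0 ?mulr_ge0.
have e2 : (t2 ^+ 2) ^+ 2 <= W ^+ 2 * t4 ^+ 2.
  by rewrite -exprMn; apply: lerXn2r; rewrite ?nnegrE ?sqr_ge0 ?mulr_ge0.
apply: le_trans e1 _.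
rewrite -[7%N]/(4 + 3)%N exprD -mulrA; apply: ler_wpM2l; first by rewrite exprn_ge0.
apply: le_trans e2 _.
rewrite [X in _ <= X * _]exprSr -(mulrA (W ^+ 2)).
by apply: ler_wpM2l; rewrite ?exprn_ge0.
Qed.

End Sums.

Section Collisions.
Variables (T : finType) (U : finType) (A : {set T}) (phi : T -> U).

(** The squared L^2 norm of the fibre sizes of [phi]. With [phi] a sum or difference map on pairs
    this is an additive energy. *)
Definition collisions : nat :=
  (\sum_(x in A) \sum_(y in A) (phi y == phi x))%N.

Let r u := (\sum_(y in A) (phi y == u))%N.

Lemma sum_fibres (R : comNzRingType) (H : U -> R) :
  \sum_(x in A) H (phi x) = \sum_u (r u)%:R * H u.
Proof.
rewrite (partition_big phi predT) //=; apply: eq_bigr => u _.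
rewrite /r natr_sum mulr_suml big_mkcondr /=; apply: eq_bigr => x _.
by case: eqP => [->|_]; rewrite ?mul1r ?mul0r.
Qed.

Lemma collisionsE (R : comNzRingType) :
  collisions%:R = \sum_u (r u)%:R ^+ 2 :> R.
Proof. by rewrite natr_sum (sum_fibres (fun u => (r u)%:R)). Qed.

Lemma collisions_cauchy_schwarz (R : realDomainType) (H : U -> R) :
  (\sum_(x in A) H (phi x)) ^+ 2 <= collisions%:R * \sum_u H u ^+ 2.
Proof. by rewrite sum_fibres collisionsE; exact: cauchy_schwarz_sum. Qed.

End Collisions.

(** Cauchy-Schwarz for the coloured map, tested on the fibre sizes of [phi], gives
    [K ^ 2 <= K' * (#|C| * K)]; then [K] cancels. *)
Lemma collisions_colour (T U C : finType) (A : {set T}) (phi : T -> U)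
    (c : T -> C) :
  (collisions A phi <= #|C| * collisions A (fun x => (phi x, c x)))%N.
Proof.
set K := collisions A phi; set K' := collisions A _.
pose r u : int := (\sum_(y in A) (phi y == u))%N%:R.
have := collisions_cauchy_schwarz A (fun x => (phi x, c x)) (fun uc => r uc.1).
have -> : \sum_(x in A) r (phi x, c x).1 = K%:R :> int by rewrite natr_sum.
have -> : \sum_(uc : U * C) r uc.1 ^+ 2 = #|C|%:R * K%:R :> int.
  transitivity (\sum_u \sum_(k : C) r u ^+ 2); first by rewrite pair_bigA.
  rewrite (collisionsE A phi).
  by rewrite mulr_sumr; apply: eq_bigr => u _; rewrite sumr_const mulr_natl.
rewrite -/K' -!natrM -natrX ler_nat -mulnn mulnA [(_ * #|C|)%N]mulnC.
by case: K => // k; rewrite leq_pmul2r.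
Qed.

(** * Additive energy on the paraboloid *)

Lemma sqr_sum_nat_le (I : finType) (A : {set I}) (f : I -> nat) :
  ((\sum_(i in A) f i) ^ 2 <= #|A| * \sum_(i in A) f i ^ 2)%N.
Proof.
have /= := cauchy_schwarz_sum (fun i => i \in A) (fun=> 1 : int) (fun i => (f i)%:R).
under eq_bigr do rewrite mul1r.
under [X in _ <= X * _ -> _]eq_bigr do rewrite expr1n.
under [X in _ <= _ * X -> _]eq_bigr do rewrite -natrX.
by rewrite sumr_const -!natr_sum -natrM -natrX ler_nat.
Qed.

Lemma sum_bool_le1 (I : finType) (A : {set I}) (P : pred I) :
  (forall x y, x \in A -> y \in A -> P x -> P y -> x = y) ->
  (\sum_(x in A) P x <= 1)%N.
Proof.
move=> uniq; rewrite -big_mkcondr /= sum1_card.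
by apply/card_le1_eqP => x y /andP[xA Px] /andP[yA Py]; exact: uniq.
Qed.

(** The Kovari-Sos-Turan argument: after Cauchy-Schwarz over [d], the pairs [a = a'] return the
    incidences, and each pair [a != a'] has at most one common [d]. *)
Lemma incidence_bound (I J : finType) (B : {set I}) (D : {set J})
    (P : I -> J -> bool) :
  (forall a a' d d', a \in B -> a' \in B -> d \in D -> d' \in D -> a != a' ->
     P a d -> P a' d -> P a d' -> P a' d' -> d = d') ->
  ((\sum_(a in B) \sum_(d in D) P a d) ^ 2
     <= #|D| * (\sum_(a in B) \sum_(d in D) P a d + #|B| ^ 2))%N.
Proof.
move=> uniq; rewrite [X in (X ^ 2)%N]exchange_big /=.
apply: leq_trans (sqr_sum_nat_le _ _) _; rewrite leq_mul2l; apply/orP; right.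
have -> : (\sum_(d in D) (\sum_(a in B) P a d) ^ 2 =
   \sum_(a in B) \sum_(a' in B) \sum_(d in D) P a d * P a' d)%N.
  rewrite (eq_bigr (fun d => \sum_(a in B) \sum_(a' in B) (P a d * P a' d))%N).
    by rewrite exchange_big; apply: eq_bigr => a _; rewrite exchange_big.
  by move=> d _; rewrite -mulnn big_distrlr.
rewrite -mulnn -sum_nat_const -big_split /=.
apply: leq_sum => a aB; rewrite (bigD1 a) //=; apply: leq_add.
  by apply: leq_sum => d _; case: (P a d).
rewrite -[X in (_ <= X)%N]sum1_card [X in (_ <= X)%N](bigID (predC1 a)) /=.
apply: leq_trans (leq_addr _ _).
apply: leq_sum => a' /andP[a'B a'a].
under eq_bigr do rewrite mulnb.
apply: sum_bool_le1 => d d' dD d'D /andP[p1 p2] /andP[p3 p4].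
by apply: (uniq a a'); rewrite // eq_sym.
Qed.

Section Paraboloid.
Variable F : finFieldType.
Implicit Types a b c d u v w : F * F.

Definition dot2 a b : F := a.1 * b.1 + a.2 * b.2.
Definition lift a : F * F * F := (a, dot2 a a).

Hypothesis nonsquareN1 : forall x : F, x ^+ 2 != -1.

Lemma two_neq0 : 2 != 0 :> F.
Proof.
apply: contra (nonsquareN1 1) => /eqP h.
by rewrite expr1n -subr_eq0 opprK; apply/eqP; rewrite -[RHS]h; ring.
Qed.

(** If [y != 0], then x^2 + y^2 = 0 would make -1 the square of [x / y]. *)
Lemma dot2_eq0 a : dot2 a a = 0 -> a = 0.
Proof.
case: a => x y; rewrite /dot2 /= => h.
have [y0|y0] := eqVneq y 0.
  move: h; rewrite y0 mulr0 addr0 => /eqP; rewrite mulf_eq0 orbb => /eqP ->.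
  by [].
have /eqP[] := nonsquareN1 (x / y).
have e : x * x = - (y * y) by apply/eqP; rewrite -addr_eq0 h.
by rewrite expr_div_n !expr2 e mulNr divff // mulf_neq0.
Qed.

(** If [d != d'], then [u] and [u'] are both orthogonal to [w], hence parallel. The right angles
    then give u.u = u.u' = u'.u', so [u - u'] is isotropic and [a = a']. *)
Lemma right_angle_uniq c a a' d d' : a != c -> a' != c -> a != a' ->
  dot2 (a - c) (a - d) = 0 -> dot2 (a' - c) (a' - d) = 0 ->
  dot2 (a - c) (a - d') = 0 -> dot2 (a' - c) (a' - d') = 0 -> d = d'.
Proof.
move=> ac a'c aa' h1 h2 h3 h4; apply/eqP; apply/contraT => dd'.
move: aa'; rewrite -subr_eq0; apply: contraR => _.
rewrite -subr_eq0 in ac; rewrite -subr_eq0 in a'c.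
pose u := a - c; pose u' := a' - c; pose v := d - c; pose w := d - d'.
have nu : dot2 u u != 0 by apply: contra ac => /eqP /dot2_eq0 /eqP.
have nu' : dot2 u' u' != 0 by apply: contra a'c => /eqP /dot2_eq0 /eqP.
have uw : dot2 u w = 0.
  transitivity (dot2 u (a - d') - dot2 u (a - d)); last by rewrite h1 h3 subrr.
  by rewrite /dot2 /w /=; ring.
have u'w : dot2 u' w = 0.
  transitivity (dot2 u' (a' - d') - dot2 u' (a' - d)); last by rewrite h2 h4 subrr.
  by rewrite /dot2 /w /=; ring.
have uv : dot2 u u = dot2 u v.
  by apply/eqP; rewrite -subr_eq0 -h1 /u /v /dot2 /=; apply/eqP; ring.
have u'v : dot2 u' u' = dot2 u' v.
  by apply/eqP; rewrite -subr_eq0 -h2 /u' /v /dot2 /=; apply/eqP; ring.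
have nw : dot2 w w != 0.
  by apply: contra dd' => /eqP /dot2_eq0 /eqP; rewrite subr_eq0.
have det0 : u.1 * u'.2 - u.2 * u'.1 = 0.
  apply: (mulfI nw); rewrite mulr0.
  transitivity ((dot2 u w) * (w.1 * u'.2 - w.2 * u'.1)
    + dot2 u' w * (w.2 * u.1 - w.1 * u.2)); first by rewrite /dot2; ring.
  by rewrite uw u'w !mul0r addr0.
have par : dot2 u' u' = dot2 u u'.
  apply: (mulfI nu); rewrite {1}u'v.
  transitivity (dot2 u u' * dot2 u v
    + (u.1 * u'.2 - u.2 * u'.1) * (u.1 * v.2 - u.2 * v.1)).
    by rewrite /dot2; ring.
  by rewrite det0 mul0r addr0 -uv mulrC.
have par' : dot2 u u = dot2 u u'.
  apply: (mulfI nu'); rewrite {1}uv.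
  transitivity (dot2 u u' * dot2 u' v
    - (u.1 * u'.2 - u.2 * u'.1) * (u'.1 * v.2 - u'.2 * v.1)).
    by rewrite /dot2; ring.
  by rewrite det0 mul0r subr0 -u'v mulrC.
apply/eqP/dot2_eq0.
transitivity (dot2 u u - dot2 u u' - (dot2 u u' - dot2 u' u')).
  by rewrite /dot2 /u /u' /=; ring.
by rewrite par par' !subrr.
Qed.

Definition energy (A : {set F * F}) : nat :=
  collisions (finset.setX A A) (fun ab => lift ab.1 + lift ab.2).

(** The right angle is at [a], with [c] and [d] on its two sides. The value [a = c] is left out
    because it makes the condition void. *)
Definition right_angles (A : {set F * F}) c : nat :=
  (\sum_(a in A :\ c) \sum_(d in A) (dot2 (a - c) (a - d) == 0)%R)%N.

(** With r right angles and n points, the incidence bound reads r^2 <= n (r + n^2), and trivially r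
    <= n^2. *)
Lemma right_angles_le (A : {set F * F}) c :
  (right_angles A c ^ 2 <= 2 * #|A| ^ 3)%N.
Proof.
have := @incidence_bound _ _ (A :\ c) A (fun a d => dot2 (a - c) (a - d) == 0).
rewrite -/(right_angles A c) => h.
have {h} := h _.
have sub : (#|A :\ c| <= #|A|)%N by rewrite subset_leq_card // subsetDl.
have tr : (right_angles A c <= #|A| * #|A|)%N.
  apply: leq_trans (_ : _ <= \sum_(a in A :\ c) #|A|)%N _.
    apply: leq_sum => a _; rewrite -sum1_card; apply: leq_sum => d _.
    by case: eqP.
  by rewrite sum_nat_const leq_mul2r sub orbT.
move=> h; apply: leq_trans (h _) _ => {h}; last first.
  rewrite (_ : 2 * #|A| ^ 3 = #|A| * (#|A| * #|A| + #|A| ^ 2))%N; last by lia.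
  by rewrite leq_mul2l leq_add ?orbT // leq_exp2r.
move=> a a' d d'; rewrite !inE => /andP[ac _] /andP[a'c _] _ _ aa'.
by move=> /eqP h1 /eqP h2 /eqP h3 /eqP h4; apply: (right_angle_uniq ac a'c aa').
Qed.

(** In [lift a + lift d = lift c + lift b] the plane coordinates force [d = c + b - a]; the last
    coordinate then says, as 2 is invertible, that the angle at [a] between [c] and [b] is right.
    The choices with [a = c] account for [#|A| ^ 2]. *)
Lemma energy_le_right_angles (A : {set F * F}) :
  (energy A <= #|A| ^ 2 + \sum_(c in A) right_angles A c)%N.
Proof.
rewrite /energy /collisions [X in (X <= _)%N]big_setX /=.
have -> : (#|A| ^ 2 + \sum_(c in A) right_angles A c =
  \sum_(c in A) (#|A| + right_angles A c))%N.
  by rewrite big_split /= sum_nat_const -mulnn.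
have le1 c : c \in A -> (\sum_(a in A) \sum_(d in A) (dot2 (a - c) (a - d) == 0)%R
   <= #|A| + right_angles A c)%N.
  move=> cA; rewrite (big_setD1 c) //=; apply: leq_add => //.
  by rewrite -sum1_card; apply: leq_sum => d _; case: eqP.
apply: leq_trans (_ : _ <= \sum_(c in A) \sum_(a in A) \sum_(d in A)
  (dot2 (a - c) (a - d) == 0)%R)%N _; last exact: leq_sum.
rewrite (eq_bigr (fun c => \sum_(b in A) \sum_(a in A) \sum_(d in A)
  (lift a + lift d == lift c + lift b)%R)%N); last first.
  by move=> c _; apply: eq_bigr => b _; rewrite [LHS]big_setX.
apply: leq_sum => c _; rewrite exchange_big /=; apply: leq_sum => a _.
apply: leq_sum => b _.
have key d : lift a + lift d = lift c + lift b ->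
    dot2 (a - c) (a - b) = 0 /\ d = c + b - a.
  move=> /eqP; rewrite xpair_eqE => /andP[/eqP /= h1 /eqP /= h2].
  have hd : d = c + b - a by rewrite -h1 addrC addrA addNr add0r.
  split=> //; apply: (mulfI two_neq0); rewrite mulr0.
  transitivity (dot2 a a + dot2 d d - (dot2 c c + dot2 b b)).
    by rewrite hd /dot2 /=; ring.
  by rewrite h2 subrr.
have [r0|r0] := boolP (dot2 (a - c) (a - b) == 0).
  by apply: sum_bool_le1 => d d' _ _ /eqP /key[_ ->] /eqP /key[_ ->].
by rewrite big1 // => d _; case: eqP => // /key[/eqP e _]; rewrite e in r0.
Qed.

(** Cauchy-Schwarz over [c] gives S^2 <= 2 n^5, and (n^2 + S)^2 <= 2 n^4 + 2 S^2. The bound is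
    squared to avoid the half-integral exponent 5/2. *)
Lemma energy_le (A : {set F * F}) : (energy A ^ 2 <= 6 * #|A| ^ 5)%N.
Proof.
have h := energy_le_right_angles A.
have h2 := sqr_sum_nat_le A (right_angles A).
have h3 : (\sum_(c in A) right_angles A c ^ 2 <= #|A| * (2 * #|A| ^ 3))%N.
  by rewrite -sum_nat_const; apply: leq_sum => c _; exact: right_angles_le.
set S := (\sum_(c in A) right_angles A c)%N in h h2.
set n := #|A| in h h2 h3 *.
have h4 : (S ^ 2 <= n * (n * (2 * n ^ 3)))%N.
  by apply: leq_trans h2 _; rewrite leq_mul2l h3 orbT.
apply: leq_trans (_ : _ <= (n ^ 2 + S) ^ 2)%N _; first by rewrite leq_exp2r.
apply: leq_trans (_ : _ <= 2 * n ^ 4 + 2 * S ^ 2)%N _.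
  rewrite sqrnD (expnM n 2 2 : n ^ 4 = (n ^ 2) ^ 2)%N.
  have [+ _] := nat_Cauchy (n ^ 2) S.
  by move: (n ^ 2 * S)%N ((n ^ 2) ^ 2)%N (S ^ 2)%N; lia.
apply: leq_trans (_ : _ <= 2 * n ^ 4 + 2 * (n * (n * (2 * n ^ 3))))%N _.
  by rewrite leq_add2l leq_mul2l h4.
have : (n ^ 4 <= n ^ 5)%N by case: (n) => // k; rewrite leq_pexp2l.
by rewrite !expnS; nia.
Qed.

End Paraboloid.

(** * The pseudo-conformal map *)

Section PseudoConformal.
Variable F : finFieldType.
Implicit Types (z t : F) (x y : F * F * F) (E : {set F * F * F}).

Hypothesis two0 : 2 != 0 :> F.

Definition slice E z : {set F * F} := [set y | (y, z) \in E].
Definition off_height E z := [set x in E | x.2 != z].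

(** Frequency at which the paraboloid sees the kernel from the plane of height [z]. At [x.2 = z] the
    inverses take the default value 0, so only [off_height] is meaningful. *)
Definition psi z x : F * F * F :=
  ((x.1.1 / (2 * (x.2 - z)), x.1.2 / (2 * (x.2 - z))), - (4 * (x.2 - z))^-1).

Lemma four_neq0 : 4 != 0 :> F.
Proof. by rewrite (_ : 4 = 2 * 2) ?mulf_neq0 //; ring. Qed.

Lemma psi_height z x y : x.2 != z -> y.2 != z ->
  (psi z x).2 = (psi z y).2 -> x.2 = y.2.
Proof.
rewrite -subr_eq0 => xz; rewrite -subr_eq0 => yz /= /oppr_inj /invr_inj.
by move/(mulfI four_neq0)/addIr.
Qed.

Lemma psi_inj E z : {in off_height E z &, injective (psi z)}.
Proof.
move=> x y; rewrite !inE => /andP[_ xz] /andP[_ yz] e.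
have h := psi_height xz yz (congr1 snd e).
have n0 : (2 * (x.2 - z))^-1 != 0 by rewrite invr_neq0 // mulf_neq0 // subr_eq0.
move: e; rewrite /psi -h => -[/(mulIf n0) e1 /(mulIf n0) e2].
by case: x y h e1 e2 {xz yz n0} => [[? ?] ?] [[? ?] ?] /= -> -> ->.
Qed.

Definition difference_energy (T : finType) (X : {set T}) (f : T -> F * F * F) : nat :=
  collisions (finset.setX X X) (fun p => f p.1 - f p.2).

(** The clause [x4.2 == x2.2] comes from colouring each pair by the height of its second point. *)
Let aligned z x1 x2 x3 x4 :=
  [&& [&& x1.2 != z, x2.2 != z, x3.2 != z & x4.2 != z],
      psi z x3 - psi z x4 == psi z x1 - psi z x2 & x4.2 == x2.2].

Lemma clear_denominators (s1 s2 u1 u2 u3 u4 : F) : s1 != 0 -> s2 != 0 ->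
  u3 / (2 * s1) - u4 / (2 * s2) = u1 / (2 * s1) - u2 / (2 * s2) ->
  (u1 - u3) * s2 = (u2 - u4) * s1.
Proof.
move=> s10 s20 e.
have {}e : u1 / (2 * s1) - u3 / (2 * s1) = u2 / (2 * s2) - u4 / (2 * s2).
  by rewrite -[u1 / _](subrK (u2 / (2 * s2))) -e; ring.
transitivity (2 * s1 * s2 * (u1 / (2 * s1) - u3 / (2 * s1))).
  by field; rewrite s10 two0.
by rewrite e; field; rewrite s20 two0.
Qed.

(** The last coordinate of [psi] determines the height, so equal heights of [x2] and [x4] force
    equal heights of [x1] and [x3]. The other coordinates give the dilation relation once
    denominators are cleared. *)
Lemma aligned_height z x1 x2 x3 x4 : aligned z x1 x2 x3 x4 ->
  [/\ x4.2 = x2.2, x3.2 = x1.2,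
     (x1.1.1 - x3.1.1) * (x2.2 - z) = (x2.1.1 - x4.1.1) * (x1.2 - z) &
     (x1.1.2 - x3.1.2) * (x2.2 - z) = (x2.1.2 - x4.1.2) * (x1.2 - z)].
Proof.
case/and3P=> /and4P[z1 z2 z3 z4] /eqP e /eqP h42.
have h31 : x3.2 = x1.2.
  apply: (psi_height z3 z1); move/(congr1 snd): e => /=; rewrite h42.
  exact: addIr.
rewrite -subr_eq0 in z1; rewrite -subr_eq0 in z2.
split=> //; apply: clear_denominators => //.
  by move/(congr1 (fun v : F * F * F => v.1.1)): e => /=; rewrite h42 h31.
by move/(congr1 (fun v : F * F * F => v.1.2)): e => /=; rewrite h42 h31.
Qed.

(** Subtracting the relations gives [d1 = d2]; either of them then reduces to
    [d1 * (t2 - t1) = 0]. *)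
Lemma two_dilations (t1 t2 z z' d1 d2 : F) : t1 != t2 -> z != z' ->
  d1 * (t2 - z) = d2 * (t1 - z) -> d1 * (t2 - z') = d2 * (t1 - z') ->
  d1 = 0 /\ d2 = 0.
Proof.
move=> t12 zz' e e'.
have d12 : d1 = d2.
  rewrite -subr_eq0 in zz'; apply: (mulfI zz').
  transitivity (d1 * (t2 - z') - d1 * (t2 - z)); first by ring.
  by rewrite e e'; ring.
suff d10 : d1 = 0 by rewrite -d12.
rewrite eq_sym -subr_eq0 in t12; apply: (mulIf t12); rewrite mul0r.
transitivity (d1 * (t2 - z) - d2 * (t1 - z)); first by rewrite d12; ring.
by rewrite e subrr.
Qed.

(* Off the degenerate configurations, the dilation ratio (t2 - z) / (t1 - z)
   determines the height z. *)
Lemma aligned_count x1 x2 x3 x4 :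
  (\sum_z aligned z x1 x2 x3 x4 <=
     #|F| * [&& x2.2 == x1.2, x3.2 == x1.2 & x4 == (x3 - x1 + x2)%R]
     + #|F| * [&& x3 == x1 & x4 == x2]
     + [&& x3.2 == x1.2 & x4.2 == x2.2])%N.
Proof.
have triv : (\sum_z aligned z x1 x2 x3 x4 <= #|F|)%N.
  by rewrite -sum1_card; apply: leq_sum => z _; case: aligned.
have [c1|c1] := boolP [&& x2.2 == x1.2, _ & _].
  by rewrite muln1 -addnA; apply: leq_trans triv (leq_addr _ _).
have [c2|c2] := boolP [&& x3 == x1 & x4 == x2].
  by rewrite muln0 add0n muln1; apply: leq_trans triv (leq_addr _ _).
rewrite !muln0 !add0n.
have [c3|c3] := boolP [&& x3.2 == x1.2 & x4.2 == x2.2]; last first.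
  rewrite big1 // => z _; case al: aligned => //.
  by case: (aligned_height al) => /eqP e1 /eqP e2; rewrite e1 e2 in c3.
rewrite (eq_bigl (fun z => z \in [set: F])); last by move=> z; rewrite inE.
apply: sum_bool_le1 => z z' _ _ al al'; apply/eqP; apply: contraT => zz'.
have [h42 h31 e1 e2] := aligned_height al.
have [_ _ e1' e2'] := aligned_height al'.
have nz : x1.2 - z != 0 by rewrite subr_eq0; case/and3P: al => /and4P[].
(* At equal heights the dilation ratio is 1, so [x4 = x3 - x1 + x2], which [c1] excludes. At
   different heights a second [z'] forces [x3 = x1] and [x4 = x2], which [c2] excludes. *)
have [h21|h21] := eqVneq x1.2 x2.2.
  move: c1; rewrite -h21 h31 !eqxx /= => /negP[]; apply/eqP.
  rewrite -h21 in e1 e2.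
  move: (mulIf nz e1) (mulIf nz e2) h42; rewrite -h21 => f1 f2 h42.
  case: x1 x2 x3 x4 f1 f2 h21 h31 h42 {c2 c3 triv al al' e1 e2 e1' e2' nz}
    => [[a1 b1] t1] [[a2 b2] t2] [[a3 b3] t3] [[a4 b4] t4] /= f1 f2 h21 h31 h42.
  rewrite h42 h31 -h21; congr (_, _, _) => /=.
  - by rewrite -[a4](subKr a2) -f1; ring.
  - by rewrite -[b4](subKr b2) -f2; ring.
  - by ring.
have [/eqP a1 /eqP a2] := two_dilations h21 zz' e1 e1'.
have [/eqP b1 /eqP b2] := two_dilations h21 zz' e2 e2'.
move: a1 a2 b1 b2; rewrite !subr_eq0 => /eqP a1 /eqP a2 /eqP b1 /eqP b2.
case/negP: c2.
case: x1 x2 x3 x4 a1 a2 b1 b2 h31 h42 {c1 c3 triv al al' e1 e2 e1' e2' nz h21}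
  => [[? ?] ?] [[? ?] ?] [[? ?] ?] [[? ?] ?] /= -> -> -> -> -> ->.
by rewrite !eqxx.
Qed.

Lemma slice_card E t : (\sum_(x in E) (x.2 == t) = #|slice E t|)%N.
Proof.
have inj : injective (fun y : F * F => (y, t)) by move=> y y' [].
rewrite -big_mkcondr /= sum1_card -(card_imset _ inj).
apply: eq_card => -[y s]; apply/andP/imsetP => /= [[ys /eqP e]|[y']].
  by exists y; rewrite ?inE -e.
by rewrite inE => y'E [-> ->].
Qed.

(** The outer [#|F|] is the cost of colouring. The three terms count parallelograms in one plane and
    trivial quadruples, each for up to [#|F|] values of [z], and quadruples on two pairs of equal
    heights, each for at most one [z]. *)
Lemma sum_difference_energy_le E m : (forall t, #|slice E t| <= m)%N ->
  (\sum_z difference_energy (off_height E z) (psi z)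
    <= #|F| * (#|F| * #|E| * m ^ 2 + #|F| * #|E| ^ 2 + #|E| ^ 2 * m ^ 2))%N.
Proof.
move=> hm; pose X z := finset.setX (off_height E z) (off_height E z).
pose coll z := collisions (X z) (fun p => (psi z p.1 - psi z p.2, p.2.2)).
apply: leq_trans (_ : _ <= \sum_z #|F| * coll z)%N _.
  by apply: leq_sum => z _; exact: collisions_colour.
rewrite -big_distrr /= leq_mul2l; apply/orP; right.
have collE z : (coll z <= \sum_(x1 in E) \sum_(x2 in E) \sum_(x3 in E)
    \sum_(x4 in E) aligned z x1 x2 x3 x4)%N.
  have offE (f : F * F * F -> nat) : (\sum_(x in off_height E z) f x =
      \sum_(x in E | x.2 != z) f x)%N.
    by apply: eq_bigl => x; rewrite inE.
  rewrite /coll /collisions [X in (X <= _)%N]big_setX /= offE big_mkcondr /=.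
  apply: leq_sum => x1 _; case: ifP => z1 //.
  rewrite offE big_mkcondr /=; apply: leq_sum => x2 _; case: ifP => z2 //.
  rewrite [X in (X <= _)%N]big_setX /= offE big_mkcondr /=.
  apply: leq_sum => x3 _; case: ifP => z3 //.
  rewrite offE big_mkcondr /=; apply: leq_sum => x4 _; case: ifP => z4 //.
  by rewrite /aligned z1 z2 z3 z4 /= xpair_eqE.
apply: leq_trans (_ : _ <= \sum_z \sum_(x1 in E) \sum_(x2 in E)
    \sum_(x3 in E) \sum_(x4 in E) aligned z x1 x2 x3 x4)%N _.
  by apply: leq_sum => z _; exact: collE.
have sumt t : (\sum_(x in E) (x.2 == t) <= m)%N by rewrite slice_card.
have sum1 (a : F * F * F) : (\sum_(x in E) (x == a) <= 1)%N.
  by apply: sum_bool_le1 => x y _ _ /eqP -> /eqP ->.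
rewrite exchange_big /=.
have -> : (#|F| * #|E| * m ^ 2 + #|F| * #|E| ^ 2 + #|E| ^ 2 * m ^ 2 =
   \sum_(x1 in E) (#|F| * (m * m) + #|E| * (#|F| + m * m)))%N.
  by rewrite sum_nat_const; lia.
apply: leq_sum => x1 _; rewrite exchange_big /=.
apply: leq_trans (_ : _ <=
  \sum_(x2 in E) ((#|F| * m) * (x2.2 == x1.2) + (#|F| + m * m)))%N _; last first.
  rewrite big_split /= -big_distrr sum_nat_const leq_add2r mulnA leq_mul2l.
  by rewrite sumt orbT.
apply: leq_sum => x2 _; rewrite exchange_big /=.
apply: leq_trans (_ : _ <= \sum_(x3 in E) ((#|F| * (x2.2 == x1.2)) * (x3.2 == x1.2)
   + #|F| * (x3 == x1) + m * (x3.2 == x1.2)))%N _; last first.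
  rewrite !big_split /= -!big_distrr -addnA; apply: leq_add.
    by rewrite -mulnA [(m * _)%N]mulnC mulnA leq_mul2l sumt orbT.
  by rewrite leq_add // ?leq_mul2l ?sumt ?orbT // -[leqRHS]muln1 leq_mul2l sum1 orbT.
apply: leq_sum => x3 _; rewrite exchange_big /=.
apply: leq_trans (_ : _ <= \sum_(x4 in E)
  ((#|F| * (x2.2 == x1.2) * (x3.2 == x1.2)) * (x4 == (x3 - x1 + x2)%R)
   + #|F| * (x3 == x1) * (x4 == x2) + (x3.2 == x1.2) * (x4.2 == x2.2)))%N _.
  apply: leq_sum => x4 _; apply: leq_trans (aligned_count _ _ _ _) _.
  by rewrite -!mulnb !mulnA.
rewrite !big_split /= -!big_distrr /=; apply: leq_add; last first.
  by rewrite mulnC leq_mul2r sumt orbT.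
by apply: leq_add; rewrite -[leqRHS]muln1 leq_mul2l sum1 orbT.
Qed.

End PseudoConformal.

(** * Characters and exponential sums *)

Section Modulus.
Variable R : realType.
Implicit Types z w : R[i].

Lemma cmodE z : `|z| = (cmod z)%:C. Proof. by []. Qed.

Lemma cmod_ge0 z : 0 <= cmod z.
Proof. by rewrite -ler0c -cmodE normr_ge0. Qed.

Lemma cmodM z w : cmod (z * w) = cmod z * cmod w.
Proof. exact: ComplexField.Normc.normcM. Qed.

Lemma cmod_real (x : R) : 0 <= x -> cmod x%:C = x.
Proof. by move=> x0; apply: complexI; rewrite -cmodE ger0_norm // ler0c. Qed.

Lemma cmod1 : cmod (1 : R[i]) = 1. Proof. exact: ComplexField.Normc.normc1. Qed.

Lemma cmod0 : cmod (0 : R[i]) = 0. Proof. exact: ComplexField.Normc.normc0. Qed.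

Lemma cmod_eq0 z : cmod z = 0 -> z = 0.
Proof. exact: ComplexField.Normc.eq0_normc. Qed.

Lemma cmodX z n : cmod (z ^+ n) = cmod z ^+ n.
Proof. by elim: n => [|n IHn]; rewrite ?expr0 ?cmod1 // !exprS cmodM IHn. Qed.

Lemma cmod_sum (I : finType) (P : pred I) (f : I -> R[i]) :
  cmod (\sum_(i | P i) f i) <= \sum_(i | P i) cmod (f i).
Proof.
rewrite -lecR -cmodE; apply: le_trans (ler_norm_sum _ _ _) _.
by rewrite [leRHS]raddf_sum.
Qed.

Definition cconj z : R[i] := z^*.

Lemma cconjM z w : cconj (z * w) = cconj z * cconj w.
Proof. exact: rmorphM. Qed.

Lemma cmod_sqr z : (cmod z ^+ 2)%:C = z * cconj z.
Proof. by rewrite rmorphXn /= -cmodE sqr_normc. Qed.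

Lemma cmod_conj z : cmod (cconj z) = cmod z.
Proof. by case: z => a b; rewrite /cmod !normc_def /= sqrrN. Qed.

Lemma cmod_sum_sqr (I : finType) (P : pred I) (f : I -> R[i]) :
  (cmod (\sum_(i | P i) f i) ^+ 2)%:C
    = \sum_(i | P i) \sum_(j | P j) f i * cconj (f j).
Proof. by rewrite cmod_sqr /cconj rmorph_sum big_distrlr. Qed.

Lemma phase z : exists2 u : R[i], cmod u = 1 & u * z = (cmod z)%:C.
Proof.
have [->|z0] := eqVneq z 0; first by exists 1; rewrite ?cmod1 // mulr0 cmod0.
have m0 : cmod z != 0 by apply: contra z0 => /eqP /cmod_eq0 /eqP.
exists ((cmod z)%:C / z); last by rewrite divfK.
by apply: (mulIf m0); rewrite -cmodM divfK // mul1r cmod_real // cmod_ge0.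
Qed.

End Modulus.

Section Characters.
Variables (R : realType) (F : finFieldType) (e : F -> R[i]).
Hypotheses (e_char : additive_character e) (e_nonpr : nonprincipal e).
Hypothesis two0 : 2 != 0 :> F.
Let q : R := #|F|%:R.

Let e0 : e 0 = 1 := e_char.1.
Let eD x y : e (x + y) = e x * e y := e_char.2 x y.

Lemma card_field_gt0 : 0 < #|F|%:R :> R.
Proof. by rewrite ltr0n; apply/card_gt0P; exists 0. Qed.
Let q0 : 0 < q := card_field_gt0.

(** Translating the product of all values of [e] by [x] multiplies it by [e x ^+ #|F|], so [e x] is
    a root of unity. *)
Lemma char_cmod x : cmod (e x) = 1.
Proof.
have e_neq0 y : e y != 0.
  apply/eqP => ey; have := eD y (- y).
  by rewrite subrr e0 ey mul0r => /eqP; rewrite oner_eq0.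
have xq : e x ^+ #|F| = 1.
  have p0 : \prod_y e y != 0 by apply/prodf_neq0.
  apply: (mulIf p0); rewrite mul1r {2}(reindex_inj (addrI x)) /=.
  under [RHS]eq_bigr do rewrite eD.
  by rewrite big_split prodr_const.
apply/eqP; rewrite -(@pexpr_eq1 _ _ #|F|) ?cmod_ge0 //.
  by rewrite -cmodX xq cmod1.
by apply/card_gt0P; exists 0.
Qed.

Lemma charN x : e (- x) = cconj (e x).
Proof.
have n0 : e x != 0.
  apply: contra_eqN (char_cmod x) => /eqP ->; by rewrite cmod0 eq_sym oner_eq0.
apply: (mulfI n0); rewrite -eD subrr e0 -cmod_sqr char_cmod expr1n.
by [].
Qed.

Lemma sum_char (a : F) : \sum_x e (x * a) = (q * (a == 0)%:R)%:C.
Proof.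
have [->|a0] := eqVneq a 0.
  under eq_bigr do rewrite mulr0 e0.
  by rewrite sumr_const mulr1 /q rmorph_nat.
rewrite mulr0 /=; have [c ec] := e_nonpr.
set S := \sum_x _.
have : S = e c * S.
  rewrite {1}/S (reindex_inj (addrI (c / a))) mulr_sumr /=.
  by apply: eq_bigr => x _; rewrite mulrDl divfK // eD.
move/eqP; rewrite -subr_eq0 -{1}[S]mul1r -mulrBl mulf_eq0 subr_eq0 eq_sym.
by rewrite (negPf ec) => /eqP.
Qed.

Definition dot3 (v w : F * F * F) : F := dot2 v.1 w.1 + v.2 * w.2.

Lemma dot3Dr u v w : dot3 u (v + w) = dot3 u v + dot3 u w.
Proof. by rewrite /dot3 /dot2 /=; ring. Qed.

Lemma dot3Br u v w : dot3 u (v - w) = dot3 u v - dot3 u w.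
Proof. by rewrite /dot3 /dot2 /=; ring. Qed.

Lemma dot3Bl u v w : dot3 (u - v) w = dot3 u w - dot3 v w.
Proof. by rewrite /dot3 /dot2 /=; ring. Qed.

Lemma sum_char2 (a : F * F) : \sum_v e (dot2 v a) = (q ^+ 2 * (a == 0)%:R)%:C.
Proof.
case: a => a b; rewrite -(pair_bigA _ (fun x y => e (dot2 (x, y) (a, b)))) /=.
rewrite (eq_bigr (fun x => e (x * a) * \sum_y e (y * b))); last first.
  by move=> x _; rewrite mulr_sumr; apply: eq_bigr => y _; rewrite -eD.
rewrite -mulr_suml !sum_char -rmorphM /=; congr (_%:C).
rewrite -[(a, b) == 0]/((a == 0) && (b == 0)).
by rewrite -mulnb natrM expr2 mulrACA.
Qed.

Lemma sum_char3 (a : F * F * F) : \sum_v e (dot3 v a) = (q ^+ 3 * (a == 0)%:R)%:C.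
Proof.
case: a => a b; rewrite -(pair_bigA _ (fun x y => e (dot3 (x, y) (a, b)))) /=.
rewrite (eq_bigr (fun x => e (dot2 x a) * \sum_y e (y * b))); last first.
  by move=> x _; rewrite mulr_sumr; apply: eq_bigr => y _; rewrite -eD.
rewrite -mulr_suml sum_char2 sum_char -rmorphM /=; congr (_%:C).
rewrite -[(a, b) == 0]/((a == 0) && (b == 0)).
by rewrite -mulnb natrM (exprSr q 2) mulrACA.
Qed.

(** Opening the square and summing over [v] first, orthogonality keeps exactly the colliding pairs,
    with coefficients of modulus at most 1. *)
Lemma bessel (T : finType) (X : {set T}) (phi : T -> F * F * F) (c : T -> R[i]) :
  (forall x, cmod (c x) <= 1) ->
  \sum_v cmod (\sum_(x in X) c x * e (dot3 v (phi x))) ^+ 2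
    <= q ^+ 3 * (collisions X phi)%:R.
Proof.
move=> c1; set S := \sum_v _.
have S0 : 0 <= S by apply: sumr_ge0 => v _; exact: sqr_ge0.
have -> : S = cmod (\sum_(x in X) \sum_(y in X)
    c x * cconj (c y) * (q ^+ 3 * (phi x - phi y == 0)%:R)%:C).
  rewrite -[LHS]cmod_real //; congr (cmod _); rewrite raddf_sum /=.
  under eq_bigr do rewrite cmod_sum_sqr.
  rewrite exchange_big; apply: eq_bigr => x _.
  rewrite exchange_big; apply: eq_bigr => y _ /=.
  rewrite -sum_char3 mulr_sumr; apply: eq_bigr => v _.
  by rewrite cconjM -charN mulrACA -eD -dot3Br.
apply: le_trans (cmod_sum _ _) _; rewrite natr_sum mulr_sumr.
apply: ler_sum => x _; apply: le_trans (cmod_sum _ _) _.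
rewrite natr_sum mulr_sumr; apply: ler_sum => y _.
rewrite !cmodM cmod_conj cmod_real; last by rewrite mulr_ge0 ?exprn_ge0 // ltW.
rewrite subr_eq0 eq_sym ler_piMl //; first by rewrite mulr_ge0 ?exprn_ge0 // ltW.
by rewrite mulr_ile1 ?cmod_ge0 ?c1.
Qed.

Definition expsum (A : {set F * F}) (c : F * F -> R[i]) (v : F * F * F) : R[i] :=
  \sum_(y in A) c y * e (dot3 v (lift y)).

(** The square of the sum is again an exponential sum, over pairs with frequencies
    [lift a + lift b]. *)
Lemma expsum_fourth_moment A c : (forall y, cmod (c y) <= 1) ->
  \sum_v cmod (expsum A c v) ^+ 4 <= q ^+ 3 * (energy A)%:R.
Proof.
move=> c1.
apply: le_trans (bessel (c := fun p => c p.1 * c p.2) _ _ _); last first.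
  by move=> p; rewrite cmodM mulr_ile1 ?cmod_ge0 ?c1.
apply: ler_sum => v _; rewrite -[4%N]/(2 * 2)%N exprM -cmodX.
suff -> : expsum A c v ^+ 2 = \sum_(p in finset.setX A A)
  c p.1 * c p.2 * e (dot3 v (lift p.1 + lift p.2)) by [].
rewrite big_setX expr2 /expsum big_distrlr /=.
apply: eq_bigr => a _; apply: eq_bigr => b _.
by rewrite dot3Dr eD mulrACA.
Qed.

(** Two uses of Cauchy-Schwarz; injectivity of [f] bounds the sum over [X] by the full fourth
    moment. *)
Lemma expsum_fourth_power (T : finType) (X : {set T}) (f : T -> F * F * F) A c :
  (forall y, cmod (c y) <= 1) -> {in X &, injective f} ->
  (\sum_(x in X) cmod (expsum A c (f x))) ^+ 4
    <= #|X|%:R ^+ 3 * (q ^+ 3 * (energy A)%:R).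
Proof.
move=> c1 f_inj.
have cs g : (\sum_(x in X) g x) ^+ 2 <= #|X|%:R * \sum_(x in X) g x ^+ 2 :> R.
  have := weighted_sum_sqr (P := fun x => x \in X) (w := fun=> 1) g (fun _ _ => ler01).
  rewrite sumr_const; under eq_bigr do rewrite mul1r.
  by under [X in _ <= _ * X -> _]eq_bigr do rewrite mul1r.
set M := \sum_(x in X) _; have h1 := cs (fun x => cmod (expsum A c (f x))).
have := cs (fun x => cmod (expsum A c (f x)) ^+ 2).
under [X in _ <= _ * X -> _]eq_bigr do rewrite -exprM.
rewrite -/M in h1 * => h2.
have h3 : \sum_(x in X) cmod (expsum A c (f x)) ^+ 4 <= q ^+ 3 * (energy A)%:R.
  apply: le_trans (expsum_fourth_moment _ c1).
  rewrite -(big_imset (fun v => cmod (expsum A c v) ^+ 4)) //=.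
  rewrite [leRHS](bigID (mem (f @: X))) /= lerDl sumr_ge0 // => v _.
  by rewrite exprn_ge0 ?cmod_ge0.
rewrite -[4%N]/(2 * 2)%N exprM.
set s2 := \sum_(x in X) _ in h1 h2.
have s20 : 0 <= s2 by apply: sumr_ge0 => x _; exact: sqr_ge0.
have n0 : 0 <= #|X|%:R :> R by [].
apply: le_trans (_ : _ <= (#|X|%:R * s2) ^+ 2) _.
  by apply: lerXn2r; rewrite ?nnegrE ?sqr_ge0 ?mulr_ge0.
rewrite exprMn [X in _ <= X * _]exprSr -[leRHS]mulrA ler_wpM2l ?sqr_ge0 //.
by apply: le_trans h2 _; rewrite ler_wpM2l.
Qed.

(** Quantifies the additive structure of a large spectrum: a large sum over [X] forces many
    coincidences among the differences [f x - f x']. *)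
Lemma expsum_eighth_power (T : finType) (X : {set T}) (f : T -> F * F * F) A c :
  (forall y, cmod (c y) <= 1) ->
  (\sum_(x in X) cmod (expsum A c (f x))) ^+ 8
    <= #|A|%:R ^+ 4 * #|X|%:R ^+ 4 * (difference_energy X f)%:R
       * (q ^+ 3 * (energy A)%:R).
Proof.
move=> c1; set M := \sum_(x in X) _.
have [theta th1 thE] : exists2 th : T -> R[i], forall x, cmod (th x) = 1 &
    forall x, th x * expsum A c (f x) = (cmod (expsum A c (f x)))%:C.
  have /boolp.choice[th H] x : exists u, cmod u = 1 /\
      u * expsum A c (f x) = (cmod (expsum A c (f x)))%:C.
    by have [u u1 u2] := phase (expsum A c (f x)); exists u.
  by exists th => x; case: (H x).
pose D y := \sum_(x in X) theta x * e (dot3 (f x) (lift y)).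
pose H v := cmod (expsum A (fun=> 1) v).
pose Q := \sum_(p in finset.setX X X) H (f p.1 - f p.2).
have M0 : 0 <= M by apply: sumr_ge0 => x _; exact: cmod_ge0.
have h1 : M <= \sum_(y in A) cmod (D y).
  have -> : M = cmod (\sum_(y in A) c y * D y).
    rewrite -[LHS]cmod_real //; congr cmod; rewrite raddf_sum /=.
    under eq_bigr do rewrite -thE /expsum mulr_sumr.
    rewrite exchange_big /=; apply: eq_bigr => y _; rewrite mulr_sumr.
    by apply: eq_bigr => x _; rewrite mulrCA.
  apply: le_trans (cmod_sum _ _) _; apply: ler_sum => y _.
  by rewrite cmodM ler_piMl ?cmod_ge0.
have h2 : M ^+ 2 <= #|A|%:R * \sum_(y in A) cmod (D y) ^+ 2.
  apply: le_trans (_ : _ <= (\sum_(y in A) 1 * cmod (D y)) ^+ 2) _.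
    apply: lerXn2r; rewrite ?nnegrE //.
      by apply: sumr_ge0 => y _; rewrite mul1r cmod_ge0.
    by under eq_bigr do rewrite mul1r.
  apply: le_trans (cauchy_schwarz_sum _ _ _) _.
  by under eq_bigr do rewrite expr1n; rewrite sumr_const.
(* Opening the square moves the frequencies to differences and removes the weights [c]. *)
have h3 : \sum_(y in A) cmod (D y) ^+ 2 <= Q.
  set S := \sum_(y in A) _.
  have S0 : 0 <= S by apply: sumr_ge0 => y _; exact: sqr_ge0.
  have -> : S = cmod (\sum_(p in finset.setX X X)
      theta p.1 * cconj (theta p.2) * expsum A (fun=> 1) (f p.1 - f p.2)).
    rewrite -[LHS]cmod_real //; congr (cmod _); rewrite raddf_sum /= big_setX /=.
    under eq_bigr do rewrite cmod_sum_sqr.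
    rewrite exchange_big; apply: eq_bigr => x _.
    rewrite exchange_big; apply: eq_bigr => x' _ /=.
    rewrite /expsum mulr_sumr; apply: eq_bigr => y _.
    by rewrite cconjM -charN mulrACA -eD mul1r dot3Bl.
  apply: le_trans (cmod_sum _ _) _; apply: ler_sum => p _.
  by rewrite !cmodM cmod_conj !th1 !mul1r.
have Q0 : 0 <= Q by apply: sumr_ge0 => p _; exact: cmod_ge0.
have h4 : Q ^+ 2 <= #|X|%:R ^+ 2 * \sum_(p in finset.setX X X) H (f p.1 - f p.2) ^+ 2.
  apply: le_trans (_ : _ <= (\sum_(p in finset.setX X X) 1 * H (f p.1 - f p.2)) ^+ 2) _.
    by under [X in _ <= X ^+ 2]eq_bigr do rewrite mul1r.
  apply: le_trans (cauchy_schwarz_sum _ _ _) _.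
  by under eq_bigr do rewrite expr1n; rewrite sumr_const cardsX natrM.
(* Grouping pairs by their difference separates the energy of [X] from the fourth moment over
   [A]. *)
have h5 : (\sum_(p in finset.setX X X) H (f p.1 - f p.2) ^+ 2) ^+ 2 <=
    (difference_energy X f)%:R * (q ^+ 3 * (energy A)%:R).
  apply: le_trans (collisions_cauchy_schwarz _ (fun p => f p.1 - f p.2)
    (fun v => H v ^+ 2)) _.
  apply: ler_wpM2l => //; under eq_bigr do rewrite -exprM.
  by apply: expsum_fourth_moment => y; rewrite cmod1.
set s := \sum_(p in finset.setX X X) _ in h4 h5.
have s0 : 0 <= s by apply: sumr_ge0 => p _; exact: sqr_ge0.
have {}h2 : M ^+ 2 <= #|A|%:R * Q.
  by apply: le_trans h2 _; rewrite ler_wpM2l.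
have h6 : M ^+ 8 <= (#|A|%:R * Q) ^+ 4.
  rewrite -[8%N]/(2 * 4)%N exprM; apply: lerXn2r => //.
  - by rewrite nnegrE sqr_ge0.
  - by rewrite nnegrE mulr_ge0.
apply: le_trans h6 _.
rewrite exprMn -2!(mulrA (#|A|%:R ^+ 4)) -(mulrA (#|X|%:R ^+ 4)).
rewrite ler_wpM2l ?exprn_ge0 //.
rewrite (exprM Q 2 2 : Q ^+ 4 = _).
apply: le_trans (_ : _ <= (#|X|%:R ^+ 2 * s) ^+ 2) _.
  by apply: lerXn2r; rewrite ?nnegrE ?sqr_ge0 ?mulr_ge0 ?sqr_ge0.
by rewrite exprMn -exprM ler_wpM2l ?exprn_ge0.
Qed.

End Characters.

(** * The kernel and duality *)

Section Kernel.
Variables (R : realType) (F : finFieldType) (e : F -> R[i]).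
Hypotheses (e_char : additive_character e) (e_nonpr : nonprincipal e).
Hypothesis two0 : 2 != 0 :> F.
Let q : R := #|F|%:R.
Let q0 : 0 < q := card_field_gt0 R F.

Let e0 : e 0 = 1 := e_char.1.
Let eD x y : e (x + y) = e x * e y := e_char.2 x y.

Definition kernel (u : F * F * F) : R[i] := \sum_w e (dot3 u (lift w)).

Lemma kernel_horizontal a : kernel (a, 0) = (q ^+ 2 * (a == 0)%:R)%:C.
Proof.
rewrite -(sum_char2 e_char e_nonpr); apply: eq_bigr => w _; congr e.
by rewrite /dot3 /lift /dot2 /=; ring.
Qed.

Definition gauss (t : F) : R[i] := \sum_w e (t * dot2 w w).

(** The shift by [c] completes the square. *)
Lemma kernel_off_horizontal a t : t != 0 ->
  kernel (a, t) = e (- (dot2 a a / (4 * t))) * gauss t.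
Proof.
move=> t0; pose c : F * F := (- (a.1 / (2 * t)), - (a.2 / (2 * t))).
rewrite /kernel (reindex_inj (addrI c)) /gauss mulr_sumr /=.
apply: eq_bigr => w _; rewrite -eD; congr e.
by rewrite /dot3 /lift /dot2 /c /=; field; rewrite t0 two0 (four_neq0 two0).
Qed.

(** In the squared modulus, replacing one variable by [w + d] leaves a linear character sum in [w],
    which vanishes unless [d = 0]. *)
Lemma gauss_cmod t : t != 0 -> cmod (gauss t) = q.
Proof.
move=> t0; apply/eqP.
rewrite -(eqrXn2 (n := 2)) ?cmod_ge0 ?(ltW q0) //; apply/eqP/complexI.
rewrite cmod_sum_sqr exchange_big /=.
transitivity (\sum_d e (t * dot2 d d) * \sum_w e (dot2 w (2 * t * d.1, 2 * t * d.2))).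
  rewrite (eq_bigr (fun w => \sum_d e (t * dot2 d d)
      * e (dot2 w (2 * t * d.1, 2 * t * d.2)))).
    by rewrite exchange_big; apply: eq_bigr => d _; rewrite -mulr_sumr.
  move=> w _; rewrite (reindex_inj (addrI w)) /=; apply: eq_bigr => d _.
  rewrite -(charN e_char) -!eD; congr e; rewrite /dot2 /=; ring.
rewrite (bigD1 (0, 0)) //= [X in _ + X]big1 ?addr0 => [|d d0].
  rewrite (_ : dot2 _ _ = 0) ?mulr0 ?e0 ?mul1r; last by rewrite /dot2 /= !mulr0 addr0.
  by rewrite (sum_char2 e_char e_nonpr) eqxx mulr1.
rewrite (sum_char2 e_char e_nonpr) xpair_eqE !mulf_eq0 (negPf t0) (negPf two0) /=.
rewrite (_ : (_ && _) = false) ?mulr0 //.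
by case: d d0 => d1 d2; rewrite xpair_eqE => /negPf.
Qed.

(** In the expanded Gaussian phase the term in [x] alone factors out with modulus 1; the mixed term
    and the term in [y] form [dot3 (psi z x) (lift y)]. *)
Lemma kernel_slice (A : {set F * F}) (c : F * F -> R[i]) z x : x.2 != z ->
  cmod (\sum_(y in A) c y * kernel (x - (y, z)))
    = q * cmod (expsum e A c (psi z x)).
Proof.
move=> xz; have t0 : x.2 - z != 0 by rewrite subr_eq0.
rewrite (eq_bigr (fun y => e (- (dot2 x.1 x.1 / (4 * (x.2 - z)))) * gauss (x.2 - z)
    * (c y * e (dot3 (psi z x) (lift y))))); last first.
  move=> y _; rewrite (_ : x - (y, z) = (x.1 - y, x.2 - z)); last by case: x {xz t0}.
  rewrite kernel_off_horizontal // [RHS]mulrCA; congr (_ * _).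
  rewrite mulrAC -eD; congr (e _ * _).
  rewrite /dot3 /lift /dot2 /psi /=; field.
  by rewrite t0 two0 (four_neq0 two0).
by rewrite -mulr_sumr !cmodM (char_cmod e_char) mul1r gauss_cmod.
Qed.

Definition extension3 (g : F * F -> R[i]) (x : F * F * F) : R[i] :=
  ((q ^+ 2)^-1)%:C * \sum_w g w * e (dot3 x (lift w)).

Definition slice_sum (E : {set F * F * F}) (c : F * F * F -> R[i]) z : R :=
  \sum_(x in off_height E z) cmod (expsum e (slice E z) (fun y => c (y, z)) (psi z x)).

Lemma sum_slices (V : nmodType) (E : {set F * F * F}) (f : F * F * F -> V) :
  \sum_(x in E) f x = \sum_z \sum_(y in slice E z) f (y, z).
Proof.
rewrite (exchange_big_dep predT) //= pair_big_dep /=.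
by apply: eq_big => [[y z]|[y z]] //=; rewrite inE.
Qed.

Lemma level_set_bound (g : F * F -> R[i]) (E : {set F * F * F}) (lam B : R) :
  0 <= lam -> 0 < B -> B ^+ 2 = (q ^+ 2)^-1 * \sum_w cmod (g w) ^+ 2 ->
  (forall x, x \in E -> lam * B <= cmod (extension3 g x)) ->
  exists2 c : F * F * F -> R[i], forall x, cmod (c x) = 1 &
    q * (lam ^+ 2 * #|E|%:R ^+ 2) <= q * #|E|%:R + \sum_z slice_sum E c z.
Proof.
move=> lam0 B0 BE hE.
have [th th1 thE] : exists2 th : F * F * F -> R[i], forall x, cmod (th x) = 1 &
    forall x, th x * extension3 g x = (cmod (extension3 g x))%:C.
  have /boolp.choice[th H] x : exists u, cmod u = 1 /\
      u * extension3 g x = (cmod (extension3 g x))%:C.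
    by have [u u1 u2] := phase (extension3 g x); exists u.
  by exists th => x; case: (H x).
exists (fun x => cconj (th x)); first by move=> x; rewrite cmod_conj.
set N : R := #|E|%:R.
pose D w := \sum_(x in E) th x * e (dot3 x (lift w)).
have q20 : 0 < (q ^+ 2)^-1 by rewrite invr_gt0 exprn_gt0.
have N0 : 0 <= N by [].
(* The phases [th] turn the sum of moduli over [E] into a pairing of [g] with [D]. *)
have h1 : lam * B * N <= (q ^+ 2)^-1 * \sum_w cmod (g w) * cmod (D w).
  apply: le_trans (_ : _ <= \sum_(x in E) cmod (extension3 g x)) _.
    by rewrite /N mulr_natr -sumr_const; apply: ler_sum => x xE; exact: hE.
  have -> : \sum_(x in E) cmod (extension3 g x) =
      cmod (((q ^+ 2)^-1)%:C * \sum_w g w * D w).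
    rewrite -[LHS]cmod_real; last by apply: sumr_ge0 => x _; exact: cmod_ge0.
    congr (cmod _); rewrite raddf_sum /=; under eq_bigr do rewrite -thE.
    rewrite mulr_sumr /D /extension3.
    under eq_bigr do rewrite mulrCA mulr_sumr mulr_sumr.
    rewrite exchange_big /=; apply: eq_bigr => w _.
    rewrite !mulr_sumr; apply: eq_bigr => x _.
    by rewrite [th x * (_ * _)]mulrCA.
  rewrite cmodM cmod_real ?(ltW q20) // ler_wpM2l ?(ltW q20) //.
  apply: le_trans (cmod_sum _ _) _.
  by apply: ler_sum => w _; rewrite cmodM.
(* Cauchy-Schwarz in [w]; the factor from [g] is [B ^+ 2], which cancels. *)
have h2 : lam ^+ 2 * N ^+ 2 <= (q ^+ 2)^-1 * \sum_w cmod (D w) ^+ 2.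
  have B20 : 0 < B ^+ 2 by rewrite exprn_gt0.
  rewrite -(ler_pM2l B20).
  apply: le_trans (_ : _ <= ((q ^+ 2)^-1 * \sum_w cmod (g w) * cmod (D w)) ^+ 2) _.
    rewrite -!exprMn mulrA [B * lam]mulrC; apply: lerXn2r => //.
      by rewrite nnegrE !mulr_ge0 // ltW.
    rewrite nnegrE mulr_ge0 ?(ltW q20) //; apply: sumr_ge0 => w _.
    by rewrite mulr_ge0 ?cmod_ge0.
  set k := (q ^+ 2)^-1 in q20 *.
  rewrite BE exprMn (expr2 k) [leRHS]mulrACA ler_wpM2l ?mulr_ge0 ?(ltW q20) //.
  by apply: cauchy_schwarz_sum.
have h3 : \sum_w cmod (D w) ^+ 2 <=
    q ^+ 2 * N + q * \sum_z slice_sum E (fun x => cconj (th x)) z.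
  set S := \sum_w _.
  have S0 : 0 <= S by apply: sumr_ge0 => w _; exact: sqr_ge0.
  have -> : S = cmod (\sum_(x in E) th x * \sum_(y in E) cconj (th y) * kernel (x - y)).
    rewrite -[LHS]cmod_real //; congr (cmod _); rewrite raddf_sum /=.
    under eq_bigr do rewrite cmod_sum_sqr.
    rewrite exchange_big; apply: eq_bigr => x _ /=.
    rewrite mulr_sumr exchange_big; apply: eq_bigr => y _ /=.
    rewrite mulrA /kernel mulr_sumr; apply: eq_bigr => w _.
    by rewrite cconjM -(charN e_char) mulrACA -eD dot3Bl.
  apply: le_trans (_ : _ <= \sum_(x in E) \sum_z cmod (\sum_(y in slice E z)
     cconj (th (y, z)) * kernel (x - (y, z)))) _.
    apply: le_trans (cmod_sum _ _) _; apply: ler_sum => x _.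
    rewrite cmodM th1 mul1r sum_slices; exact: cmod_sum.
  rewrite mulr_sumr /N mulr_natr -sumr_const.
  rewrite [leLHS](eq_bigr (fun x => cmod (\sum_(y in slice E x.2)
     cconj (th (y, x.2)) * kernel (x - (y, x.2))) +
     \sum_(z | z != x.2) cmod (\sum_(y in slice E z)
     cconj (th (y, z)) * kernel (x - (y, z))))); last first.
    by move=> x _; rewrite (bigD1 x.2).
  rewrite big_split; apply: lerD => /=.
    (* In the plane of [x] the kernel is a point mass at [y = x], which yields the diagonal term
       [q ^+ 2 * N]. *)
    apply: ler_sum => x xE.
    have xs : x.1 \in slice E x.2 by rewrite inE; case: x xE.
    rewrite (bigD1 x.1) //= big1 ?addr0 => [|y /andP[_ yx]].
      rewrite (_ : x - _ = (0, 0)); last by case: x {xE xs} => a b; rewrite /= subrr.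
      rewrite cmodM cmod_conj th1 mul1r kernel_horizontal eqxx mulr1.
      by rewrite cmod_real ?exprn_ge0 ?(ltW q0).
    rewrite (_ : x - _ = (x.1 - y, 0)).
      by rewrite kernel_horizontal subr_eq0 eq_sym (negPf yx) !mulr0.
    by case: x {xE xs yx} => a b /=; congr (_, _); rewrite /= subrr.
  rewrite (exchange_big_dep predT) //=; apply: ler_sum => z _.
  rewrite /slice_sum mulr_sumr [leLHS](eq_bigl (fun x => x \in off_height E z)).
    apply: ler_sum => x; rewrite inE => /andP[_ xz].
    by rewrite kernel_slice.
  by move=> x; rewrite inE eq_sym.
rewrite -(ler_pM2l q0) mulrDr.
apply: le_trans (_ : _ <= q ^+ 2 * ((q ^+ 2)^-1 * \sum_w cmod (D w) ^+ 2)) _.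
  by rewrite [leLHS]mulrA -expr2 ler_wpM2l // exprn_ge0 // ltW.
rewrite mulrA divff ?mul1r; last by rewrite gt_eqF // exprn_gt0.
by apply: le_trans h3 _; rewrite [q * (q * _)]mulrA -expr2.
Qed.

End Kernel.

(** * Bounds in terms of the slices *)

Lemma ler_exprn2r (R : realDomainType) (x y : R) n :
  0 <= x -> x <= y -> x ^+ n <= y ^+ n.
Proof. by move=> x0 xy; apply: lerXn2r; rewrite ?nnegrE // (le_trans x0). Qed.

Section Slices.
Variables (R : realType) (F : finFieldType) (e : F -> R[i]).
Hypotheses (e_char : additive_character e) (e_nonpr : nonprincipal e).
Hypothesis nonsquareN1 : forall x : F, x ^+ 2 != -1.
Let q : R := #|F|%:R.
Let q0 : 0 < q := card_field_gt0 R F.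
Let two0 : 2 != 0 :> F := two_neq0 nonsquareN1.

Variables (E : {set F * F * F}) (c : F * F * F -> R[i]).
Hypothesis c1 : forall x, cmod (c x) = 1.
Let N : R := #|E|%:R.
Let n z : R := #|slice E z|%:R.
Let X : R := \sum_z slice_sum e E c z.

Let cz1 z y : cmod (c (y, z)) <= 1. Proof. by rewrite c1. Qed.

Lemma slice_sum_ge0 z : 0 <= slice_sum e E c z.
Proof. by apply: sumr_ge0 => x _; exact: cmod_ge0. Qed.

Lemma card_slices : \sum_z n z = N.
Proof.
rewrite /N -sum1_card natr_sum sum_slices.
by apply: eq_bigr => z _; rewrite sumr_const.
Qed.

Lemma off_height_le z : #|off_height E z|%:R <= N :> R.
Proof.
rewrite ler_nat; apply: subset_leq_card.
by apply/fintype.subsetP => x; rewrite inE => /andP[].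
Qed.

Lemma slice_sum_le z : slice_sum e E c z <= N * n z.
Proof.
apply: le_trans (_ : _ <= \sum_(x in off_height E z) n z) _.
  apply: ler_sum => x _; apply: le_trans (cmod_sum _ _) _.
  rewrite /n -sumr_const; apply: ler_sum => y _.
  by rewrite cmodM c1 (char_cmod e_char) mulr1.
by rewrite sumr_const -mulr_natl ler_wpM2r // off_height_le.
Qed.

Lemma slice_sum_eq0 z : n z = 0 -> slice_sum e E c z = 0.
Proof.
move=> nz; apply/eqP; rewrite eq_le slice_sum_ge0 andbT.
by apply: le_trans (slice_sum_le z) _; rewrite nz mulr0.
Qed.

Lemma energy_sqr_le z : (energy (slice E z))%:R ^+ 2 <= 6 * n z ^+ 5.
Proof. by rewrite /n -!natrX -natrM ler_nat energy_le. Qed.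

Lemma slice_sum_exp8 z : slice_sum e E c z ^+ 8 <= 6 * N ^+ 6 * q ^+ 6 * n z ^+ 5.
Proof.
have := expsum_fourth_power e_char e_nonpr (slice E z) (cz1 z)
  (@psi_inj _ two0 E z).
rewrite -/(slice_sum e E c z) -/q => h.
have {}h : slice_sum e E c z ^+ 4 <= N ^+ 3 * (q ^+ 3 * (energy (slice E z))%:R).
  apply: le_trans h _; rewrite ler_wpM2r ?mulr_ge0 ?exprn_ge0 ?(ltW q0) //.
  by apply: ler_exprn2r => //; exact: off_height_le.
rewrite (exprM _ 4 2 : _ ^+ 8 = _); apply: le_trans (ler_exprn2r 2 _ h) _.
  by rewrite exprn_ge0 // slice_sum_ge0.
rewrite [leRHS](_ : _ = N ^+ 6 * q ^+ 6 * (6 * n z ^+ 5)); last by ring.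
rewrite [leLHS](_ : _ = N ^+ 6 * q ^+ 6 * (energy (slice E z))%:R ^+ 2); last by ring.
rewrite ler_wpM2l ?energy_sqr_le //.
by rewrite mulr_ge0 // exprn_ge0 // ltW.
Qed.

Lemma slice_sum_exp8_energy z : slice_sum e E c z ^+ 8 <=
  n z ^+ 4 * N ^+ 4 * (difference_energy (off_height E z) (psi z))%:R
  * (q ^+ 3 * (energy (slice E z))%:R).
Proof.
apply: le_trans (expsum_eighth_power e_char e_nonpr _ _ _ (cz1 z)) _.
rewrite ler_wpM2r ?mulr_ge0 ?exprn_ge0 ?(ltW q0) // ler_wpM2r //.
rewrite ler_wpM2l ?exprn_ge0 //.
by apply: ler_exprn2r => //; exact: off_height_le.
Qed.

(** Power mean inequality with weights [n z], of total mass [N], for the quotients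
    [slice_sum e E c z / n z]; empty slices contribute 0. *)
Lemma sum_slice_sum_exp8 (f : F -> R) :
  (forall z, 0 < n z -> slice_sum e E c z ^+ 8 <= n z ^+ 7 * f z) ->
  (forall z, 0 <= f z) ->
  X ^+ 8 <= N ^+ 7 * \sum_z f z.
Proof.
move=> hf f0.
have uE z : n z * (slice_sum e E c z / n z) = slice_sum e E c z.
  have [nz|nz] := eqVneq (n z) 0; last by rewrite mulrC divfK.
  by rewrite nz mul0r slice_sum_eq0.
rewrite -card_slices.
have -> : X = \sum_z n z * (slice_sum e E c z / n z).
  by apply: eq_bigr => z _; rewrite uE.
apply: le_trans (weighted_sum_exp8 _ _) _ => // [z _|].
  by rewrite divr_ge0 ?slice_sum_ge0.
rewrite ler_wpM2l //; first by rewrite exprn_ge0 // sumr_ge0.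
apply: ler_sum => z _; have [nz|nz] := eqVneq (n z) 0; first by rewrite nz mul0r.
have nz0 : 0 < n z by rewrite lt_def nz /=.
have n70 : 0 < n z ^+ 7 by rewrite exprn_gt0.
rewrite -(ler_pM2l n70) mulrA -exprSr expr_div_n mulrC divfK ?hf //.
by rewrite expf_neq0.
Qed.

Lemma sum_slice_sum_large (k : R) : 0 < k ->
  (forall z, 0 < n z -> k <= n z) ->
  X ^+ 8 * k ^+ 3 <= 6 * q ^+ 6 * N ^+ 14.
Proof.
move=> k0 hk; have k30 : 0 < k ^+ 3 by rewrite exprn_gt0.
rewrite -ler_pdivlMr //.
(* Since [n z >= k], the factor [n z ^+ 5] is at most [n z ^+ 8 / k ^+ 3]; the spare [n z] sums to
   [N]. *)
have := @sum_slice_sum_exp8 (fun z => 6 * N ^+ 6 * q ^+ 6 / k ^+ 3 * n z).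
rewrite -mulr_sumr card_slices.
rewrite (_ : N ^+ 7 * _ = 6 * q ^+ 6 * N ^+ 14 / k ^+ 3); last by ring.
apply=> [z nz|z]; last first.
  by rewrite mulr_ge0 // divr_ge0 ?mulr_ge0 ?exprn_ge0 // ltW.
apply: le_trans (slice_sum_exp8 z) _.
rewrite [leRHS](_ : _ = 6 * N ^+ 6 * q ^+ 6 * n z ^+ 5 * (n z ^+ 3 / k ^+ 3)); last first.
  by ring.
rewrite ler_peMr ?mulr_ge0 ?exprn_ge0 ?(ltW q0) //.
by rewrite ler_pdivlMr // mul1r ler_exprn2r ?hk // ltW.
Qed.

Lemma sum_slice_sum_energy (k : R) : 0 < k ->
  (forall z, 0 < n z -> k <= n z) ->
  X ^+ 16 * k <= 6 * q ^+ 6 * N ^+ 22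
    * (\sum_z difference_energy (off_height E z) (psi z))%N%:R ^+ 2.
Proof.
(* Chosen so that a slice with [n z >= k] has energy at most [n z ^+ 3 * r]; with the factor
   [n z ^+ 4] this makes the required seventh power. *)
move=> k0 hk; set r := Num.sqrt (6 / k).
have r0 : 0 <= r := sqrtr_ge0 _.
have r2 : r ^+ 2 = 6 / k by rewrite sqr_sqrtr // divr_ge0 // ltW.
pose D z : R := (difference_energy (off_height E z) (psi z))%:R.
have h : X ^+ 8 <= N ^+ 7 * \sum_z (N ^+ 4 * q ^+ 3 * r) * D z.
  apply: sum_slice_sum_exp8 => [z nz|z]; last first.
    by rewrite !mulr_ge0 ?exprn_ge0 // ltW.
  apply: le_trans (slice_sum_exp8_energy z) _; rewrite -/(D z).
  rewrite [leRHS](_ : _ = n z ^+ 4 * N ^+ 4 * D z * (q ^+ 3 * (n z ^+ 3 * r))); last first.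
    by ring.
  rewrite ler_wpM2l ?mulr_ge0 ?exprn_ge0 // ler_wpM2l ?exprn_ge0 ?(ltW q0) //.
  rewrite -(ler_pXn2r (n := 2)) ?nnegrE ?mulr_ge0 ?exprn_ge0 //.
  apply: le_trans (energy_sqr_le z) _; rewrite exprMn r2.
  rewrite [leRHS](_ : _ = 6 * n z ^+ 5 * (n z / k)); last by ring.
  by rewrite ler_peMr ?mulr_ge0 ?exprn_ge0 // ler_pdivlMr // mul1r hk.
have X0 : 0 <= X by apply: sumr_ge0 => z _; exact: slice_sum_ge0.
have {}h := ler_exprn2r 2 (exprn_ge0 8 X0) h.
rewrite -exprM -mulr_sumr -natr_sum in h.
rewrite -ler_pdivlMr //; apply: le_trans h _.
set S := (\sum_z _)%N%:R.
rewrite [leLHS](_ : _ = (q ^+ 6 * N ^+ 22 * S ^+ 2) * r ^+ 2); last by ring.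
by rewrite r2 le_eqVlt; apply/orP; left; apply/eqP; ring.
Qed.

Variable t : R.
Hypothesis t2 : 2 <= t.
Hypothesis hX : q * (t * N) <= q * N + X.

Let t0 : 0 < t. Proof. by apply: lt_le_trans t2. Qed.

(** As [t >= 2], the diagonal term is at most half of the left side and is absorbed. *)
Lemma half_sum : q * (t * N) <= 2 * X.
Proof.
have : q * N * 2 <= q * N * t by rewrite ler_wpM2l // mulr_ge0 // ltW.
rewrite (_ : q * N * t = q * (t * N)); last by ring.
by move: hX; lra.
Qed.

(** The trivial bound [N * n z] for each slice sum gives [X <= N * N], to be compared with
    [half_sum]. *)
Lemma card_ge_field : 0 < N -> q <= N.
Proof.
move=> N0.
have XN : X <= N * N.
  apply: le_trans (ler_sum _ (fun z _ => slice_sum_le z)) _.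
  by rewrite -mulr_sumr card_slices.
have := le_trans half_sum (ler_wpM2l (ler0n R 2) XN).
have : q * N * 2 <= q * N * t by rewrite ler_wpM2l // mulr_ge0 // ltW.
rewrite (_ : q * N * t = q * (t * N)); last by ring.
by rewrite -(ler_pM2r N0 q); lra.
Qed.

Lemma large_slices (k : R) : 0 < N -> 0 < k ->
  (forall z, 0 < n z -> k <= n z) ->
  q ^+ 2 * t ^+ 8 * k ^+ 3 <= 2 ^+ 8 * 6 * N ^+ 6.
Proof.
move=> N0 k0 hk.
have X0 : 0 <= X by apply: sumr_ge0 => z _; exact: slice_sum_ge0.
have h : (q * (t * N)) ^+ 8 <= (2 * X) ^+ 8.
  by apply: ler_exprn2r half_sum; rewrite !mulr_ge0 // ltW.
have h' := sum_slice_sum_large k0 hk.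
have P0 : 0 < q ^+ 6 * N ^+ 8 by rewrite mulr_gt0 ?exprn_gt0.
rewrite -(ler_pM2l P0).
apply: le_trans (_ : _ <= (2 * X) ^+ 8 * k ^+ 3) _.
  rewrite [leLHS](_ : _ = (q * (t * N)) ^+ 8 * k ^+ 3); last by ring.
  by rewrite ler_wpM2r // exprn_ge0 // ltW.
rewrite [leLHS](_ : _ = 2 ^+ 8 * (X ^+ 8 * k ^+ 3)); last by ring.
rewrite [leRHS](_ : _ = 2 ^+ 8 * (6 * q ^+ 6 * N ^+ 14)); last by ring.
by rewrite ler_wpM2l // exprn_ge0.
Qed.

Lemma small_slices (k m : R) : 0 < N -> 0 < k -> q <= m ^+ 2 -> 0 < m ->
  (forall z, 0 < n z -> k <= n z) -> (forall z, n z <= m) ->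
  q ^+ 8 * t ^+ 16 * k <= 2 ^+ 16 * 54 * N ^+ 10 * m ^+ 4.
Proof.
move=> N0 k0 qm m0 hk hm.
have X0 : 0 <= X by apply: sumr_ge0 => z _; exact: slice_sum_ge0.
have h : (q * (t * N)) ^+ 16 <= (2 * X) ^+ 16.
  by apply: ler_exprn2r half_sum; rewrite !mulr_ge0 // ltW.
have h' := sum_slice_sum_energy k0 hk.
set S := (\sum_z _)%N in h'.
pose M := (\max_z #|slice E z|)%N.
have Mm : M%:R <= m.
  rewrite /M; elim/big_ind: _ => [|a b am bm|z _]; [exact: ltW| |exact: hm].
  by rewrite /maxn; case: ifP.
(* By [q <= N] and [q <= m ^+ 2], all three terms of the energy count are at most
   [q * N ^+ 2 * m ^+ 2]. *)
have SM : S%:R <= 3 * q * N ^+ 2 * m ^+ 2.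
  have := @sum_difference_energy_le F two0 E M (fun z => leq_bigmax z).
  rewrite -/S -(ler_nat R) => /le_trans; apply.
  rewrite [leLHS](_ : _ = q * (q * N * M%:R ^+ 2 + q * N ^+ 2 + N ^+ 2 * M%:R ^+ 2)); last first.
    by rewrite -mulnn !(natrM, natrD, natrX) /q /N; ring.
  have Mm2 : M%:R ^+ 2 <= m ^+ 2 by apply: ler_exprn2r.
  have qN := card_ge_field N0.
  have a1 : q * N * M%:R ^+ 2 <= N * N * m ^+ 2.
    by rewrite ler_pM ?mulr_ge0 ?exprn_ge0 ?(ltW q0) // ler_wpM2r.
  have a2 : q * N ^+ 2 <= m ^+ 2 * N ^+ 2 by rewrite ler_wpM2r ?exprn_ge0.
  have a3 : N ^+ 2 * M%:R ^+ 2 <= N ^+ 2 * m ^+ 2 by rewrite ler_wpM2l ?exprn_ge0.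
  rewrite [leRHS](_ : _ = q * (N * N * m ^+ 2 + m ^+ 2 * N ^+ 2 + N ^+ 2 * m ^+ 2)); last first.
    by ring.
  by rewrite ler_wpM2l ?(ltW q0) // lerD // lerD.
have P0 : 0 < q ^+ 8 * N ^+ 16 by rewrite mulr_gt0 ?exprn_gt0.
rewrite -(ler_pM2l P0).
apply: le_trans (_ : _ <= (2 * X) ^+ 16 * k) _.
  rewrite [leLHS](_ : _ = (q * (t * N)) ^+ 16 * k); last by ring.
  by rewrite ler_wpM2r // ltW.
rewrite [leLHS](_ : _ = 2 ^+ 16 * (X ^+ 16 * k)); last by ring.
apply: le_trans (_ : _ <= 2 ^+ 16 * (6 * q ^+ 6 * N ^+ 22 * (3 * q * N ^+ 2 * m ^+ 2) ^+ 2)) _.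
  rewrite ler_wpM2l ?exprn_ge0 //; apply: le_trans h' _.
  rewrite ler_wpM2l ?mulr_ge0 ?exprn_ge0 ?(ltW q0) //.
  exact: ler_exprn2r.
by rewrite le_eqVlt; apply/orP; left; apply/eqP; ring.
Qed.

End Slices.

(** * Eliminating the field size for sets with regular slices *)

Section Regular.
Variables (R : realType) (F : finFieldType) (e : F -> R[i]).
Hypotheses (e_char : additive_character e) (e_nonpr : nonprincipal e).
Hypothesis nonsquareN1 : forall x : F, x ^+ 2 != -1.
Let q : R := #|F|%:R.
Let q0 : 0 < q := card_field_gt0 R F.

(** The constants of [large_slices] and [small_slices]; [regular_const] and [small_const] include
    the factors 8 and 2 that arise at [k = N / (2 * q)]. *)
Definition regular_const : R := 2 ^+ 11 * 6.
Definition large_const : R := 2 ^+ 8 * 6.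
Definition small_const : R := 2 ^+ 17 * 54.
Definition weak_const : R :=
  regular_const ^+ 32 * large_const ^+ 7 + regular_const ^+ 25 * small_const ^+ 7.

Lemma weak_const_ge0 : 0 <= weak_const.
Proof. by rewrite /weak_const addr_ge0 ?mulr_ge0 ?exprn_ge0 ?mulr_ge0. Qed.

(* With [t = lam^2 N], the fourth moment gives [t^8 <= C q N^3] in all cases.  The
   threshold [q^(6/7)] for the size of the slices is the one for which eliminating
   [q] leads to the same exponents for large and for small slices. *)
Lemma weak_regular (E : {set F * F * F}) (c : F * F * F -> R[i]) (t : R) :
  (forall x, cmod (c x) = 1) -> 2 <= t -> (0 < #|E|)%N ->
  q * (t * #|E|%:R) <= q * #|E|%:R + \sum_z slice_sum e E c z ->
  (forall z, 0 < #|slice E z| -> #|E| <= 2 * #|F| * #|slice E z|)%N ->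
  (forall z, #|slice E z| ^ 7 <= #|F| ^ 6)%N \/
    (forall z, 0 < #|slice E z| -> #|F| ^ 6 <= #|slice E z| ^ 7)%N ->
  t ^+ 312 <= weak_const * #|E|%:R ^+ 138.
Proof.
move=> c1 t2 N0 hX reg cases; set N : R := #|E|%:R.
have {}N0 : 0 < N by rewrite ltr0n.
have t0 : 0 < t by apply: lt_le_trans t2.
have k0 : 0 < N / (2 * q) by rewrite divr_gt0 ?mulr_gt0.
have hk z : 0 < #|slice E z|%:R :> R -> N / (2 * q) <= #|slice E z|%:R.
  rewrite ltr0n => /reg; rewrite -(ler_nat R) !natrM => h.
  by rewrite ler_pdivrMr ?mulr_gt0 // mulrC.
have hA : t ^+ 8 <= regular_const * q * N ^+ 3.
  have := large_slices e_char e_nonpr nonsquareN1 c1 t2 hX N0 k0 hk.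
  rewrite -/N -/q => h.
  have P0 : 0 < N ^+ 3 / (8 * q) by rewrite divr_gt0 ?exprn_gt0 ?mulr_gt0.
  rewrite -(ler_pM2l P0).
  rewrite [leLHS](_ : _ = q ^+ 2 * t ^+ 8 * (N / (2 * q)) ^+ 3); last first.
    by field; rewrite gt_eqF.
  rewrite [leRHS](_ : _ = 2 ^+ 8 * 6 * N ^+ 6) //.
  by rewrite /regular_const; field; rewrite gt_eqF.
pose m : R := q `^ (6 / 7).
have m0 : 0 < m by exact: powR_gt0.
have m7 : m ^+ 7 = q ^+ 6.
  rewrite -powR_mulrn ?(ltW m0) // /m -powRrM.
  by rewrite divfK ?pnatr_eq0 // powR_mulrn // ltW.
have rA : 0 <= regular_const by rewrite /regular_const mulr_ge0.
have rB : 0 <= large_const by rewrite /large_const mulr_ge0.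
have rC : 0 <= small_const by rewrite /small_const mulr_ge0.
have pow n (x y : R) : 0 <= x -> x <= y -> x ^+ n <= y ^+ n.
  by move=> ? ?; apply: ler_exprn2r.
case: cases => [small|large].
  have hm z : #|slice E z|%:R <= m.
    rewrite -(ler_pXn2r (n := 7)) ?nnegrE ?(ltW m0) // m7 -!natrX ler_nat.
    exact: small.
  have qm : q <= m ^+ 2.
    rewrite -(ler_pXn2r (n := 7)) ?nnegrE ?exprn_ge0 ?(ltW m0) ?(ltW q0) //.
    rewrite -exprM mulnC exprM m7 -exprM ler_weXn2l //.
    by rewrite ler1n -(ltr0n R).
  have := small_slices e_char e_nonpr nonsquareN1 c1 t2 hX N0 k0 qm m0 hk hm.
  rewrite -/N -/q => h.
  have {}h : q ^+ 7 * t ^+ 16 <= small_const * N ^+ 9 * m ^+ 4.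
    have P0 : 0 < N / 2 by rewrite divr_gt0.
    rewrite -(ler_pM2l P0).
    rewrite [leLHS](_ : _ = q ^+ 8 * t ^+ 16 * (N / (2 * q))); last first.
      by field; rewrite gt_eqF.
    apply: le_trans h _; rewrite /small_const le_eqVlt; apply/orP; left.
    by apply/eqP; field.
  (* Seventh powers clear the fractional exponent in [m]. *)
  have {}h : (q ^+ 7 * t ^+ 16) ^+ 7 <= (small_const * N ^+ 9 * m ^+ 4) ^+ 7.
    by apply: pow => //; rewrite mulr_ge0 ?exprn_ge0 // ltW.
  have {}h : q ^+ 25 * t ^+ 112 <= small_const ^+ 7 * N ^+ 63.
    have P0 : 0 < q ^+ 24 by rewrite exprn_gt0.
    rewrite -(ler_pM2l P0).
    rewrite [leLHS](_ : _ = (q ^+ 7 * t ^+ 16) ^+ 7); last by ring.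
    apply: le_trans h _; rewrite [leLHS](_ : _ = small_const ^+ 7 * N ^+ 63 * (m ^+ 7) ^+ 4); last first.
      by ring.
    by rewrite m7 le_eqVlt; apply/orP; left; apply/eqP; ring.
  (* The power 25 cancels [q]: 8 * 25 + 112 = 312 and 3 * 25 + 63 = 138. *)
  have hA25 := pow 25%N _ _ (exprn_ge0 8 (ltW t0)) hA.
  have P0 : 0 < q ^+ 25 by rewrite exprn_gt0.
  rewrite -(ler_pM2l P0).
  rewrite [leLHS](_ : _ = (t ^+ 8) ^+ 25 * (q ^+ 25 * t ^+ 112)); last by ring.
  apply: le_trans (ler_pM _ _ hA25 h) _.
  - by rewrite !exprn_ge0 // ltW.
  - by rewrite mulr_ge0 ?exprn_ge0 // ltW.
  rewrite [leLHS](_ : _ = q ^+ 25 * (regular_const ^+ 25 * small_const ^+ 7 * N ^+ 138)); last first.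
    by ring.
  rewrite ler_wpM2l ?exprn_ge0 ?(ltW q0) // ler_wpM2r ?exprn_ge0 ?(ltW N0) //.
  by rewrite /weak_const lerDr mulr_ge0 ?exprn_ge0.
have hm z : 0 < #|slice E z|%:R :> R -> m <= #|slice E z|%:R.
  rewrite ltr0n => /large nz.
  by rewrite -(ler_pXn2r (n := 7)) ?nnegrE ?(ltW m0) // m7 -!natrX ler_nat.
have := large_slices e_char e_nonpr nonsquareN1 c1 t2 hX N0 m0 hm.
rewrite -/N -/q => h.
have {}h : (q ^+ 2 * t ^+ 8 * m ^+ 3) ^+ 7 <= (large_const * N ^+ 6) ^+ 7.
  by apply: pow => //; rewrite !mulr_ge0 ?exprn_ge0 // ltW.
have {}h : q ^+ 32 * t ^+ 56 <= large_const ^+ 7 * N ^+ 42.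
  rewrite [leRHS](_ : _ = (large_const * N ^+ 6) ^+ 7); last by ring.
  apply: le_trans h.
  rewrite [leRHS](_ : _ = q ^+ 14 * t ^+ 56 * (m ^+ 7) ^+ 3); last by ring.
  by rewrite m7 le_eqVlt; apply/orP; left; apply/eqP; ring.
(* Here the power 32 cancels [q]: 8 * 32 + 56 = 312 and 3 * 32 + 42 = 138. *)
have hA32 := pow 32%N _ _ (exprn_ge0 8 (ltW t0)) hA.
have P0 : 0 < q ^+ 32 by rewrite exprn_gt0.
rewrite -(ler_pM2l P0).
rewrite [leLHS](_ : _ = (t ^+ 8) ^+ 32 * (q ^+ 32 * t ^+ 56)); last by ring.
apply: le_trans (ler_pM _ _ hA32 h) _.
- by rewrite !exprn_ge0 // ltW.
- by rewrite mulr_ge0 ?exprn_ge0 // ltW.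
rewrite [leLHS](_ : _ = q ^+ 32 * (regular_const ^+ 32 * large_const ^+ 7 * N ^+ 138)); last first.
  by ring.
rewrite ler_wpM2l ?exprn_ge0 ?(ltW q0) // ler_wpM2r ?exprn_ge0 ?(ltW N0) //.
by rewrite /weak_const lerDl mulr_ge0 ?exprn_ge0.
Qed.

End Regular.

(** * Pigeonholing the heights and the weak-type estimate *)

Section WeakType.
Variables (R : realType) (F : finFieldType) (e : F -> R[i]).
Hypotheses (e_char : additive_character e) (e_nonpr : nonprincipal e).
Hypothesis nonsquareN1 : forall x : F, x ^+ 2 != -1.
Let q : R := #|F|%:R.
Let q0 : 0 < q := card_field_gt0 R F.

Definition at_heights (E : {set F * F * F}) (P : pred F) := [set x in E | P x.2].

Lemma slice_at_heights E P z :
  slice (at_heights E P) z = if P z then slice E z else finset.set0.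
Proof. by apply/setP => y; case: ifP => Pz; rewrite !inE /= Pz ?andbT ?andbF. Qed.

Lemma card_at_heights E P : (#|at_heights E P| = \sum_(z | P z) #|slice E z|)%N.
Proof.
rewrite -sum1_card sum_slices [RHS]big_mkcond; apply: eq_bigr => z _.
by rewrite slice_at_heights; case: (P z); rewrite sum1_card ?cards0.
Qed.

(** Slices below the average size by a factor 2 hold at most half of [E]. The remaining heights
    split at the threshold, and the larger class holds at least a quarter. *)
Lemma regular_heights (E : {set F * F * F}) : exists P : pred F,
  [/\ (#|E| <= 4 * #|at_heights E P|)%N,
      (forall z, P z -> #|E| <= 2 * #|F| * #|slice E z|)%N &
      (forall z, P z -> #|slice E z| ^ 7 <= #|F| ^ 6)%N \/
      (forall z, P z -> #|F| ^ 6 <= #|slice E z| ^ 7)%N].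
Proof.
pose reg z := (#|E| <= 2 * #|F| * #|slice E z|)%N.
pose small z := (#|slice E z| ^ 7 <= #|F| ^ 6)%N.
pose Ps z := reg z && small z; pose Pb z := reg z && ~~ small z.
have cE : (#|E| = \sum_z #|slice E z|)%N.
  by rewrite -sum1_card sum_slices; apply: eq_bigr => z _; rewrite sum1_card.
have split : (#|E| = #|at_heights E Ps| + #|at_heights E Pb|
    + \sum_(z | ~~ reg z) #|slice E z|)%N.
  by rewrite !card_at_heights {1}cE (bigID reg) /= (bigID small).
have irr : (2 * \sum_(z | ~~ reg z) #|slice E z| <= #|E|)%N.
  have F0 : (0 < #|F|)%N by rewrite -(ltr0n R).
  rewrite -(leq_pmul2l F0) mulnA [(#|F| * 2)%N]mulnC big_distrr /=.
  rewrite -sum_nat_const [leqRHS](bigID reg) /=; apply: leq_trans (leq_addl _ _).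
  by apply: leq_sum => z; rewrite -ltnNge => /ltnW.
have [sb|bs] := leqP #|at_heights E Ps| #|at_heights E Pb|.
  exists Pb; split; first by lia.
    by move=> z /andP[].
  by right=> z /andP[_]; rewrite -ltnNge => /ltnW.
exists Ps; split; first by lia.
  by move=> z /andP[].
by left=> z /andP[].
Qed.

Definition level_const : R := 4 ^+ 174 * (weak_const R + 2 ^+ 174).

Lemma level_const_ge0 : 0 <= level_const.
Proof.
apply: mulr_ge0; first exact: exprn_ge0.
by apply: addr_ge0; [exact: weak_const_ge0 | exact: exprn_ge0].
Qed.

Lemma weak_type (g : F * F -> R[i]) (E : {set F * F * F}) (lam B : R) :
  0 <= lam -> lam <= 1 ->
  0 < B -> B ^+ 2 = (q ^+ 2)^-1 * \sum_w cmod (g w) ^+ 2 ->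
  (forall x, x \in E -> lam * B <= cmod (extension3 e g x)) ->
  lam ^+ 624 * #|E|%:R ^+ 174 <= level_const.
Proof.
move=> lam0 lam1 B0 BE hE; have [P [card4 reg cases]] := regular_heights E.
set E' := at_heights E P in card4; pose N : R := #|E'|%:R.
have W0 := weak_const_ge0 R.
suff main : lam ^+ 624 * N ^+ 174 <= weak_const R + 2 ^+ 174.
  apply: le_trans (_ : _ <= lam ^+ 624 * (4 * N) ^+ 174) _.
    rewrite ler_wpM2l ?exprn_ge0 //; apply: ler_exprn2r => //.
    by rewrite -natrM ler_nat.
  by rewrite exprMn mulrCA ler_wpM2l ?exprn_ge0.
have [N0|N0] := posnP #|E'|.
  by rewrite /N N0 expr0n /= mulr0 addr_ge0 ?exprn_ge0.
have N0' : 0 < N by rewrite ltr0n.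
pose t := lam ^+ 2 * N.
have hE' x : x \in E' -> lam * B <= cmod (extension3 e g x).
  by rewrite inE => /andP[/hE].
have [c c1 hX] := level_set_bound e_char e_nonpr (two_neq0 nonsquareN1) lam0 B0 BE hE'.
(* For [t < 2] the bound is trivial: [lam <= 1] gives [lam ^+ 624 <= lam ^+ 348]. Otherwise
   [t ^+ 312 <= C * N ^+ 138] becomes the claim, since 312 - 138 = 174. *)
have [t2|t2] := ltP t 2.
  apply: le_trans (_ : _ <= t ^+ 174) _.
    rewrite /t exprMn -exprM ler_wpM2r ?exprn_ge0 // ?(ltW N0') //.
    exact: ler_wiXn2l.
  apply: le_trans (_ : _ <= 2 ^+ 174) _; last by rewrite lerDr.
  by apply: ler_exprn2r (ltW t2); rewrite mulr_ge0 ?exprn_ge0 // ltW.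
have P0 : 0 < N ^+ 138 by rewrite exprn_gt0.
apply: le_trans (_ : _ <= weak_const R) _; last by rewrite lerDl exprn_ge0.
rewrite -(ler_pM2r P0) -mulrA -exprD (exprM lam 2 312 : lam ^+ 624 = _) -exprMn.
have sl z : slice E' z = if P z then slice E z else finset.set0.
  exact: slice_at_heights.
apply: (weak_regular e_char e_nonpr nonsquareN1 c1 t2 N0).
- by rewrite /t -/N -mulrA -expr2.
- move=> z; rewrite sl; case: ifP => [Pz _|]; last by rewrite cards0.
  apply: leq_trans (reg z Pz); apply: subset_leq_card.
  by apply/fintype.subsetP => x; rewrite inE => /andP[].
- case: cases => h; [left|right] => z; rewrite sl; case: ifP => [Pz|_].
  + exact: h.
  + by rewrite cards0 exp0n.
  + by move=> _; exact: h.
  + by rewrite cards0.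
Qed.

End WeakType.

(** * From weak type to strong type *)

Section StrongType.
Variable R : realType.

Lemma sum_geometric_le (r : R) M : 0 <= r -> r < 1 ->
  \sum_(k < M) r ^+ k <= (1 - r)^-1.
Proof.
move=> r0 r1; have p : 0 < 1 - r by rewrite subr_gt0.
rewrite -[leRHS]mul1r ler_pdivlMr // mulrC -opprB mulNr -subrX1 opprB.
by rewrite gerBl exprn_ge0.
Qed.

Lemma dyadic_scale (y : R) : 0 < y -> y <= 1 ->
  exists k : nat, 2^-1 ^+ k.+1 <= y <= 2^-1 ^+ k.
Proof.
move=> y0 y1.
have ex : exists k : nat, 2^-1 ^+ k.+1 <= y.
  exists (Num.bound y^-1); rewrite exprVn -[leRHS]invrK.
  rewrite lef_pV2 ?posrE ?invr_gt0 ?exprn_gt0 //.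
  by apply/ltW/upper_nthrootP.
exists (ex_minn ex); case: ex_minnP => k -> hmin /=.
case: k hmin => [|k] hmin; first by rewrite expr0.
by rewrite leNgt; apply/negP => /ltW /hmin; rewrite ltnn.
Qed.

(** Level-set constant, loss of one dyadic step, and sum of the geometric series of ratio 2^(rho -
    s). *)
Definition strong_const (K rho s : R) (b : nat) : R :=
  K `^ b%:R^-1 * 2 `^ rho * (1 - 2 `^ rho / 2 `^ s)^-1.

(** Dyadic layer-cake sum: the level 2^-k costs 2^(-ks), while its level set grows only like 2^(k a
    / b), and a / b < s. *)
Lemma weak_to_strong (T : finType) (w : T -> R) (K s : R) (a b : nat) :
  (0 < b)%N -> a%:R / b%:R < s -> 0 <= K ->
  (forall x, 0 <= w x <= 1) ->
  (forall y : R, 0 <= y <= 1 -> y ^+ a * #|[set x | y <= w x]|%:R ^+ b <= K) ->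
  \sum_x w x `^ s <= strong_const K (a%:R / b%:R) s b.
Proof.
move=> b0 abs K0 w01 hw; rewrite /strong_const.
set rho := a%:R / b%:R in abs *; set D := K `^ _; set p := 2 `^ rho.
set u := 2 `^ s; have u0 : 0 < u by exact: powR_gt0.
have p0 : 0 < p by exact: powR_gt0.
have b0' : b%:R != 0 :> R by rewrite pnatr_eq0 -lt0n.
have rho0 : 0 <= rho by rewrite divr_ge0.
have s0 : 0 < s by exact: le_lt_trans abs.
have pu : p / u < 1.
  have -> : u = p * 2 `^ (s - rho).
    by rewrite /u /p -powRD ?pnatr_eq0 ?implybT // subrKC.
  rewrite invfM mulrA divff ?gt_eqF // mul1r invf_lt1 ?powR_gt0 //.
  have := @gt0_ltr_powR R (s - rho) _ 1 2.
  rewrite powR1; apply; rewrite ?nnegrE ?subr_gt0 //.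
  by rewrite ltr1n.
have L k : #|[set x | 2^-1 ^+ k.+1 <= w x]|%:R <= D * p ^+ k.+1.
  have h01 : 0 <= (2^-1 : R) ^+ k.+1 <= 1.
    apply/andP; split; first by rewrite exprn_ge0 ?invr_ge0.
    by apply: exprn_ile1; rewrite ?invr_ge0 // invf_le1 // ler1n.
  rewrite -(ler_pXn2r b0) ?nnegrE ?mulr_ge0 ?exprn_ge0 ?powR_ge0 ?(ltW p0) //.
  have -> : (D * p ^+ k.+1) ^+ b = K * (2 ^+ a) ^+ k.+1.
    have Db : D ^+ b = K.
      by rewrite -powR_mulrn ?powR_ge0 // -powRrM mulVf // powRr1.
    have pb : p ^+ b = 2 ^+ a.
      by rewrite -powR_mulrn ?(ltW p0) // -powRrM divfK // powR_mulrn.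
    by rewrite exprMn Db (exprAC p) pb.
  have := hw _ h01; set c : R := #|_|%:R.
  rewrite exprAC exprVn exprVn mulrC.
  by rewrite ler_pdivrMr ?exprn_gt0.
(* Where [w] vanishes the scale defaults to 0; the finite maximum [M] then truncates the series. *)
have /boolp.choice[kappa hk] x : exists k : nat,
    0 < w x -> 2^-1 ^+ k.+1 <= w x <= 2^-1 ^+ k.
  have [wx0|wx0] := ltP 0 (w x); last by exists 0.
  have [_ wx1] := andP (w01 x).
  by have [k hk] := dyadic_scale wx0 wx1; exists k.
pose M := (\max_x kappa x).+1.
pose v (x : T) (k : nat) : R := u ^- k * ((2^-1 ^+ k.+1 <= w x)%R : bool)%:R.
apply: le_trans (_ : _ <= \sum_x \sum_(k < M) v x k) _.
  apply: ler_sum => x _.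
  have pos k : 0 <= v x k.
    by rewrite /v mulr_ge0 ?invr_ge0 ?exprn_ge0 // ltW.
  have [wx0|wx0] := ltP 0 (w x); last first.
    have -> : w x = 0 by apply/eqP; rewrite eq_le wx0; case/andP: (w01 x).
    by rewrite powR0 ?gt_eqF // sumr_ge0.
  have /andP[k1 k2] := hk x wx0.
  have kM : (kappa x < M)%N by rewrite ltnS (leq_bigmax x).
  rewrite (bigD1 (Ordinal kM)) //= [v x (kappa x)]/v k1 mulr1.
  apply: le_trans (_ : _ <= u ^- kappa x) _; last by rewrite lerDl sumr_ge0.
  apply: le_trans (_ : _ <= (2^-1 ^+ kappa x) `^ s) _.
    apply: (ge0_ler_powR (ltW s0) _ _ k2); rewrite nnegrE ?(ltW wx0) //.
  have e1 : 2^-1 ^+ kappa x = 2 `^ (- (kappa x)%:R) :> R.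
    by rewrite exprVn powRN powR_mulrn.
  have e2 : u ^- kappa x = 2 `^ (- (s * (kappa x)%:R)).
    by rewrite powRN powRrM powR_mulrn // powR_ge0.
  by rewrite e1 e2 -powRrM mulNr mulrC.
rewrite exchange_big /=.
apply: le_trans (_ : _ <= \sum_(k < M) D * p * (p / u) ^+ k) _; last first.
  rewrite -mulr_sumr ler_wpM2l ?mulr_ge0 ?powR_ge0 //.
  by apply: sum_geometric_le => //; rewrite divr_ge0 ?ltW.
apply: ler_sum => k _; rewrite /v -mulr_sumr.
rewrite [leRHS](_ : _ = u ^- k * (D * p ^+ k.+1)); last first.
  by rewrite expr_div_n exprS; ring.
rewrite ler_wpM2l ?invr_ge0 ?exprn_ge0 ?(ltW u0) //.
apply: le_trans (L k); rewrite -sum1_card natr_sum [leRHS]big_mkcond /=.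
by apply: ler_sum => x _; rewrite inE; case: ifP.
Qed.

End StrongType.

(** * The strong estimate and its transfer to row vectors *)

Section StrongExtension.
Variables (R : realType) (F : finFieldType) (e : F -> R[i]).
Hypotheses (e_char : additive_character e) (e_nonpr : nonprincipal e).
Hypothesis nonsquareN1 : forall x : F, x ^+ 2 != -1.
Let q : R := #|F|%:R.
Let q0 : 0 < q := card_field_gt0 R F.

(** The L^1 norm is at most the L^2 norm on a probability space. This places the normalised
    extension in [0, 1], as the dyadic summation requires. *)
Lemma extension3_le (g : F * F -> R[i]) (B : R) x : 0 <= B ->
  B ^+ 2 = (q ^+ 2)^-1 * \sum_w cmod (g w) ^+ 2 ->
  cmod (extension3 e g x) <= B.
Proof.
move=> B0 BE; have k0 : 0 < (q ^+ 2)^-1 by rewrite invr_gt0 exprn_gt0.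
rewrite -(ler_pXn2r (n := 2)) ?nnegrE ?cmod_ge0 // BE cmodM cmod_real ?(ltW k0) //.
rewrite exprMn expr2 -mulrA ler_wpM2l ?(ltW k0) //.
apply: le_trans (_ : _ <= (q ^+ 2)^-1 * (\sum_w 1 * cmod (g w)) ^+ 2) _.
  rewrite ler_wpM2l ?(ltW k0) //; apply: ler_exprn2r; first exact: cmod_ge0.
  apply: le_trans (cmod_sum _ _) _; apply: ler_sum => w _.
  by rewrite cmodM (char_cmod e_char) mulr1 mul1r.
rewrite ler_pdivrMl ?exprn_gt0 //; apply: le_trans (cauchy_schwarz_sum _ _ _) _.
under eq_bigr do rewrite expr1n.
by rewrite sumr_const card_prod natrM expr2.
Qed.

Definition extension_bound (s : R) : R :=
  strong_const (level_const R) (624%:R / 174%:R) s 174 `^ s^-1.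

Lemma extension3_strong (g : F * F -> R[i]) (B s : R) :
  624 / 174 < s -> 0 <= B -> B ^+ 2 = (q ^+ 2)^-1 * \sum_w cmod (g w) ^+ 2 ->
  (\sum_x cmod (extension3 e g x) `^ s) `^ s^-1 <= extension_bound s * B.
Proof.
move=> hs B0 BE; have s0 : 0 < s by apply: lt_trans hs; rewrite divr_gt0 ?ltr0n.
have le_B x := extension3_le x B0 BE.
(* The case [B = 0] is separate because the level sets are normalised by [B]. *)
have [Bz|Bn] := eqVneq B 0.
  rewrite Bz mulr0 big1 ?powR0 ?invr_neq0 ?gt_eqF // => x _.
  rewrite (_ : cmod _ = 0) ?powR0 ?gt_eqF //.
  by apply/eqP; rewrite eq_le cmod_ge0 andbT -Bz.
have {B0 Bn}B0 : 0 < B by rewrite lt_def Bn.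
pose w x := cmod (extension3 e g x) / B.
have w0 x : 0 <= w x by rewrite divr_ge0 ?cmod_ge0 // ltW.
have hw : \sum_x w x `^ s <= strong_const (level_const R) (624%:R / 174%:R) s 174.
  apply: weak_to_strong => //.
  - exact: level_const_ge0.
  - by move=> x; rewrite w0 ler_pdivrMr // mul1r le_B.
  - move=> y /andP[y0 y1].
    apply: (weak_type e_char e_nonpr nonsquareN1 y0 y1 B0 BE) => x.
    by rewrite inE ler_pdivlMr.
have -> : \sum_x cmod (extension3 e g x) `^ s = B `^ s * \sum_x w x `^ s.
  rewrite mulr_sumr; apply: eq_bigr => x _.
  by rewrite -powRM ?(ltW B0) // mulrC divfK // gt_eqF.
rewrite powRM ?powR_ge0 ?sumr_ge0 // => [|x _]; last exact: powR_ge0.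
rewrite -powRrM divff ?gt_eqF // powRr1 ?(ltW B0) // mulrC ler_wpM2r ?(ltW B0) //.
have S0 : 0 <= \sum_x w x `^ s by apply: sumr_ge0 => x _; exact: powR_ge0.
by apply: ge0_ler_powR; rewrite ?nnegrE ?invr_ge0 ?(ltW s0) // (le_trans S0).
Qed.

Definition row2 (a : F * F) : 'rV[F]_2 := \row_i (if i == 0 then a.1 else a.2).
Definition point3 (x : 'rV[F]_3) : F * F * F := (x 0 0, x 0 1, x 0 (2%:R : 'I_3)).
Definition parab (w : 'rV[F]_2) : 'rV[F]_(2 + 1) := row_mx w (dotp w w)%:M.

Lemma row2_bij : bijective row2.
Proof.
exists (fun v : 'rV[F]_2 => (v 0 0, v 0 1)) => [[a b]|v]; first by rewrite !mxE.
by apply/rowP => i; rewrite mxE; case: i => [[|[|]]] // h; congr (v _ _); apply: ord_inj.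
Qed.

Lemma point3_bij : bijective point3.
Proof.
exists (fun x : F * F * F =>
  \row_(i < 3) (if i == 0 then x.1.1 else if i == 1 then x.1.2 else x.2)).
  move=> v; apply/rowP => i; rewrite mxE.
  by case: i => [[|[|[|]]]] // h; congr (v _ _); apply: ord_inj.
by move=> [[a b] t]; rewrite /point3 !mxE.
Qed.

Lemma dotp_parab (x : 'rV[F]_3) (a : F * F) :
  dotp x (parab (row2 a)) = dot3 (point3 x) (lift a).
Proof.
have h0 (i : 'I_(2 + 1)) : i = lshift 1 (0 : 'I_2) -> parab (row2 a) 0 i = a.1.
  by move=> ->; rewrite /parab row_mxEl mxE.
have h1 (i : 'I_(2 + 1)) : i = lshift 1 (1 : 'I_2) -> parab (row2 a) 0 i = a.2.
  by move=> ->; rewrite /parab row_mxEl mxE.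
have h2 (i : 'I_(2 + 1)) : i = rshift 2 (0 : 'I_1) -> parab (row2 a) 0 i = dot2 a a.
  move=> ->; rewrite /parab row_mxEr mxE mulr1n.
  by rewrite /dotp !big_ord_recl big_ord0 !mxE addr0.
rewrite /dotp !big_ord_recl big_ord0 addr0 h0; last exact: ord_inj.
rewrite h1; last exact: ord_inj.
rewrite h2; last exact: ord_inj.
rewrite /dot3 /dot2 /= addrA; congr (x _ _ * _ + x _ _ * _ + x _ _ * _); exact: ord_inj.
Qed.

Lemma sum_paraboloid (V : nmodType) (f : 'rV[F]_3 -> V) :
  \sum_(xi in paraboloid F) f xi = \sum_a f (parab (row2 a)).
Proof.
rewrite big_imset /= => [|v w _ _ e_vw]; last by have [] := @eq_row_mx _ 1 2 1 v _ w _ e_vw.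
rewrite (reindex row2) /=; last exact: onW_bij row2_bij.
by apply: eq_bigl => a; rewrite inE.
Qed.

Lemma card_paraboloid : #|paraboloid F| = (#|F| ^ 2)%N.
Proof.
by rewrite -sum1_card sum_paraboloid sum1_card card_prod mulnn.
Qed.

Lemma extension_paraboloid (g : 'rV[F]_3 -> R[i]) x :
  extension (paraboloid F) e g x
    = extension3 e (fun a => g (parab (row2 a))) (point3 x).
Proof.
rewrite /extension /extension3 card_paraboloid sum_paraboloid.
congr (_ * _); first by rewrite natrX fmorphV rmorphXn /= rmorph_nat.
by apply: eq_bigr => a _; rewrite dotp_parab.
Qed.

Lemma Lq_norm_extension (g : 'rV[F]_3 -> R[i]) (s : R) : 624 / 174 < s ->
  Lq_norm s (extension (paraboloid F) e g)
    <= extension_bound s * Lp_norm_sigma (paraboloid F) 2 g.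
Proof.
move=> hs; set g3 := fun a => g (parab (row2 a)).
have -> : Lq_norm s (extension (paraboloid F) e g) =
    (\sum_x cmod (extension3 e g3 x) `^ s) `^ s^-1.
  rewrite /Lq_norm; congr (_ `^ _).
  rewrite [RHS](reindex point3) /=; last exact: onW_bij point3_bij.
  by apply: eq_bigr => x _; rewrite extension_paraboloid.
have S0 : 0 <= (q ^+ 2)^-1 * \sum_a cmod (g3 a) ^+ 2.
  rewrite mulr_ge0 ?invr_ge0 ?exprn_ge0 ?(ltW q0) // sumr_ge0 // => a _.
  exact: sqr_ge0.
have BE : Lp_norm_sigma (paraboloid F) 2 g =
    Num.sqrt ((q ^+ 2)^-1 * \sum_a cmod (g3 a) ^+ 2).
  rewrite -powR12_sqrt // /Lp_norm_sigma card_paraboloid sum_paraboloid natrX.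
  congr ((_ * _) `^ _); apply: eq_bigr => a _.
  by rewrite powR_mulrn // cmod_ge0.
by rewrite BE; apply: extension3_strong; rewrite ?sqrtr_ge0 ?sqr_sqrtr.
Qed.

End StrongExtension.

Theorem corollary3 (R : realType) (eps : R) (eps_gt0 : 0 < eps) :
  exists C : R,
    forall (F : finFieldType) (e : F -> R[i]),
      prime #|F| ->
      (forall a : F, a ^+ 2 != -1) ->
      additive_character e -> nonprincipal e ->
      (extension_constant (paraboloid F) e 2 (18 / 5 - 1 / 1035 + eps)
         <= C%:E)%E.
Proof.
exists (extension_bound (18 / 5 - 1 / 1035 + eps)) => F e _ nonsq e_char e_nonpr.
apply: ereal_inf_lbound; eexists; last reflexivity; split; first exact: powR_ge0.
move=> g; apply: Lq_norm_extension => //.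
(* The weak-type exponent 624 / 174 = 18/5 - 2/145 lies below 18/5 - 1/1035. *)
by move: eps_gt0; lra.
Qed.
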